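(* Let $X,U$ be Hilbert spaces, let $\tau_{\min}>0$ and let an increasing sequence $\{t_k\}_{k\in\mathbb{N}_0}$ satisfy $t_0=0$ and $t_{k+1}-t_k\ge\tau_{\min}$ for every $k\in\mathbb{N}_0$. Assume that $A$ is the generator of a strongly continuous semigroup $T(t)$ on $X$, $B\in\mathcal{B}(U,X_{-1})$, $F\in\mathcal{B}(X,U)$ is compact, and $\phi:X\to X$ satisfies $\phi(0)=0$ and $\|\phi(\xi_1)-\phi(\xi_2)\|\le L\|\xi_1-\xi_2\|$ for all $\xi_1,\xi_2\in X$, for some $L\ge0$. Let $x^0\in X$. Then the integral equation $$x(0)=x^0,\qquad x(t_k+\tau)=T(\tau)x(t_k)+\int_0^\tau T(\tau-s)\big(BFx(t_k)+\phi(x(t_k+s))\big)ds\quad\forall\tau\in(0,t_{k+1}-t_k],\ \forall k\in\mathbb{N}_0$$ has a unique solution $x$ in $C([0,\infty),X)$. Furthermore, this solution satisfies $$x|_{[t_k,t_{k+1})}\in C^1\big([t_k,t_{k+1}),X_{-1}\big)\qquad\forall k\in\mathbb{N}_0$$ and $$\dot x(t)=Ax(t)+BFx(t_k)+\phi(x(t))\qquad\forall t\in(t_k,t_{k+1}),\ \forall k\in\mathbb{N}_0,$$ which is interpreted in $X_{-1}$.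
   Context: $\mathcal{B}(Y,Z)$ is the space of bounded linear operators from $Y$ to $Z$, and $\mathbb{N}_0=\{0,1,2,\dots\}$. The extrapolation space $X_{-1}$ associated with $T(t)$ is the completion of $X$ with respect to the norm $\|x\|_{-1}:=\|(\lambda I-A)^{-1}x\|$, where $\lambda$ is a fixed element of the resolvent set of $A$ (different $\lambda$ give equivalent norms). $T(t)$ extends to a strongly continuous semigroup on $X_{-1}$ whose generator is an extension of $A$ with domain $X$; the same symbols $T(t)$ and $A$ are used for the extensions. The integral is taken in $X_{-1}$. *)

(* Defs.v *)
From Stdlib Require Import Reals Lra.
From Coquelicot Require Export Coquelicot.
Open Scope R_scope.

(** * Scalars: real and complex spaces are treated simultaneously *)

Inductive scalars : Type := real_scalars | complex_scalars.

Definition scalar_ring (k : scalars) : AbsRing :=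
  match k with
  | real_scalars => R_AbsRing
  | complex_scalars => C_AbsRing
  end.
Coercion scalar_ring : scalars >-> AbsRing.

Definition ofR {k : scalars} : R -> k :=
  match k return R -> scalar_ring k with
  | real_scalars => fun r => r
  | complex_scalars => RtoC
  end.

Definition sconj {k : scalars} : k -> k :=
  match k return scalar_ring k -> scalar_ring k with
  | real_scalars => fun a => a
  | complex_scalars => Cconj
  end.

Lemma ofR_plus (k : scalars) (a b : R) :
  @ofR k (a + b) = plus (ofR a) (ofR b).
Proof. destruct k; [reflexivity | exact (RtoC_plus a b)]. Qed.

Lemma ofR_mult (k : scalars) (a b : R) :
  @ofR k (a * b) = mult (ofR a) (ofR b).
Proof. destruct k; [reflexivity | exact (RtoC_mult a b)]. Qed.

Lemma ofR_one (k : scalars) : @ofR k 1 = one.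
Proof. destruct k; reflexivity. Qed.

Lemma abs_ofR (k : scalars) (a : R) : abs (@ofR k a) = Rabs a.
Proof. destruct k; [reflexivity | exact (Cmod_R a)]. Qed.

(** * Restriction of scalars

    [RInt], and [is_derive] for functions of a real variable, need a normed
    module over [R].  [realify V] is [V] (same carrier, addition, norm and
    uniform structure) with scalars restricted to [R]. *)

Section Realify.

Context {k : scalars} (V : CompleteNormedModule k).

Definition real_scal (a : R) (x : V) : V := scal (@ofR k a) x.

Lemma real_scal_assoc (a b : R) (x : V) :
  real_scal a (real_scal b x) = real_scal (mult a b) x.
Proof. unfold real_scal. rewrite scal_assoc, <- ofR_mult. reflexivity. Qed.

Lemma real_scal_one (x : V) : real_scal one x = x.
Proof.
  exact (eq_trans (f_equal (fun a : k => scal a x) (ofR_one k)) (scal_one x)).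
Qed.

Lemma real_scal_distr_l (a : R) (x y : V) :
  real_scal a (plus x y) = plus (real_scal a x) (real_scal a y).
Proof. exact (scal_distr_l (ofR a : k) x y). Qed.

Lemma real_scal_distr_r (a b : R) (x : V) :
  real_scal (plus a b) x = plus (real_scal a x) (real_scal b x).
Proof.
  exact (eq_trans (f_equal (fun c : k => scal c x) (ofR_plus k a b))
           (scal_distr_r _ _ x)).
Qed.

Definition realify_ModuleSpace_mixin :=
  ModuleSpace.Mixin R_Ring (CompleteNormedModule.AbelianGroup k V) real_scal
    real_scal_assoc real_scal_one real_scal_distr_l real_scal_distr_r.

Definition realify_NormedModuleAux_class : NormedModuleAux.class_of R_AbsRing V :=
  NormedModuleAux.Class R_AbsRing V
    (ModuleSpace.Class R_Ring V _ realify_ModuleSpace_mixin)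
    (UniformSpace.class (CompleteNormedModule.UniformSpace k V)).

Definition realify_NormedModuleAux :=
  NormedModuleAux.Pack R_AbsRing V realify_NormedModuleAux_class V.

Lemma realify_norm_scal (a : R) (x : V) :
  norm (real_scal a x) <= Rabs a * norm x.
Proof. rewrite <- (abs_ofR k a). exact (norm_scal (ofR a) x). Qed.

Definition realify_NormedModule_mixin :=
  NormedModule.Mixin R_AbsRing realify_NormedModuleAux
    (fun x : V => norm x) (@norm_factor k V)
    (@norm_triangle k V) realify_norm_scal
    (@norm_compat1 k V) (@norm_compat2 k V) (@norm_eq_zero k V).

Definition realify : CompleteNormedModule R_AbsRing :=
  CompleteNormedModule.Pack R_AbsRing V
    (CompleteNormedModule.Class R_AbsRing V
       (NormedModule.Class R_AbsRing V realify_NormedModuleAux_class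
          realify_NormedModule_mixin)
       (CompleteSpace.class (CompleteNormedModule.CompleteSpace k V)))
    V.

End Realify.

(** * Hilbert spaces *)

(** Positive definiteness follows from [inner_norm]. *)
Record HilbertSpace (k : scalars) : Type := {
  hilbert_space :> CompleteNormedModule k;
  inner : hilbert_space -> hilbert_space -> k;
  inner_plus_l : forall x y z, inner (plus x y) z = plus (inner x z) (inner y z);
  inner_scal_l : forall a x y, inner (scal a x) y = mult a (inner x y);
  inner_conj : forall x y, inner y x = sconj (inner x y);
  inner_norm : forall x, inner x x = ofR (norm x ^ 2)
}.

(** * Operators

    Coquelicot's [is_linear] is linearity together with boundedness. *)

Definition compact_operator {k : scalars} {V W : NormedModule k}
    (F : V -> W) : Prop :=
  is_linear F /\
  forall u : nat -> V, (exists M : R, forall n, norm (u n) <= M) ->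
  exists (s : nat -> nat) (y : W),
    (forall n, (s n < s (S n))%nat) /\
    filterlim (fun n => F (u (s n))) eventually (locally y).

(** A semigroup is a function on [R] whose values at negative times are
    irrelevant. *)
Record C0_semigroup {k : scalars} {V : NormedModule k}
    (T : R -> V -> V) : Prop := {
  semigroup_bounded : forall t, 0 <= t -> is_linear (T t);
  semigroup_0 : forall x, T 0 x = x;
  semigroup_plus : forall s t x, 0 <= s -> 0 <= t -> T (s + t) x = T s (T t x);
  semigroup_cont : forall x, filterlim (fun h => T h x) (at_right 0) (locally x)
}.

(** An unbounded operator is a domain [D] together with a function [A] whose
    values outside [D] are irrelevant. *)

Definition generator_value {k : scalars} {V : NormedModule k}
    (T : R -> V -> V) (x y : V) : Prop :=
  filterlim (fun h => scal (@ofR k (/ h)) (minus (T h x) x))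
    (at_right 0) (locally y).

Definition is_generator {k : scalars} {V : NormedModule k}
    (T : R -> V -> V) (D : V -> Prop) (A : V -> V) : Prop :=
  (forall x, D x <-> exists y, generator_value T x y) /\
  (forall x, D x -> generator_value T x (A x)).

(** [lambda] is in the resolvent set of [(D, A)], and [Rl] is
    [(lambda I - A)^{-1}]. *)
Definition is_resolvent {k : scalars} {V : NormedModule k}
    (D : V -> Prop) (A : V -> V) (lambda : k) (Rl : V -> V) : Prop :=
  is_linear Rl /\
  (forall x, D (Rl x) /\ minus (scal lambda (Rl x)) (A (Rl x)) = x) /\
  (forall x, D x -> Rl (minus (scal lambda x) (A x)) = x).

(** * The extrapolation space *)

(** [V'], with the canonical map [j], is the completion of [V] for the norm
    [nrm]. *)
Record is_completion {k : scalars} {V : NormedModule k} (nrm : V -> R)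
    (V' : CompleteNormedModule k) (j : V -> V') : Prop := {
  completion_plus : forall x y, j (plus x y) = plus (j x) (j y);
  completion_scal : forall (a : k) x, j (scal a x) = scal a (j x);
  completion_norm : forall x, norm (j x) = nrm x;
  completion_dense : forall (y : V') (eps : posreal),
    exists x, norm (minus y (j x)) < eps
}.

Definition is_extrapolation_space {k : scalars} {V : NormedModule k}
    (D : V -> Prop) (A : V -> V) (V' : CompleteNormedModule k)
    (j : V -> V') : Prop :=
  exists (lambda : k) (Rl : V -> V),
    is_resolvent D A lambda Rl /\ is_completion (fun x => norm (Rl x)) V' j.

Definition is_semigroup_extension {k : scalars} {V V' : NormedModule k}
    (j : V -> V') (T : R -> V -> V) (T' : R -> V' -> V') : Prop :=
  C0_semigroup T' /\ forall t x, 0 <= t -> T' t (j x) = j (T t x).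

(** * Differentiability on a set of times (one-sided at end points) *)

Definition C1_on {k : scalars} {V : CompleteNormedModule k}
    (D : R -> Prop) (f : R -> V) : Prop :=
  exists g : R -> V,
    continuous_on D g /\
    forall t, D t ->
      filterdiff (U := R_NormedModule) (V := realify V) f
        (within D (locally t)) (fun h => scal (V := realify V) h (g t)).

(** * The sampled-data system

    [j] is the embedding of [X] in [X'] (the extrapolation space), and [T'] is
    the extension of [T] to [X'].  The integrand is continuous for every
    continuous [x], so that its integral is a Riemann integral in [X']. *)

Definition is_solution {k : scalars} {X U : NormedModule k}
    {X' : CompleteNormedModule k} (j : X -> X')
    (T : R -> X -> X) (T' : R -> X' -> X')
    (B : U -> X') (F : X -> U) (phi : X -> X) (t : nat -> R)
    (x0 : X) (x : R -> X) : Prop :=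
  x 0 = x0 /\
  forall (n : nat) (tau : R), 0 < tau <= t (S n) - t n ->
  exists I : X',
    is_RInt (V := realify X')
      (fun s => T' (tau - s) (plus (B (F (x (t n)))) (j (phi (x (t n + s))))))
      0 tau I /\
    j (x (t n + tau)) = plus (j (T tau (x (t n)))) I.

(* Main.v *)
Require Import Defs.
From Stdlib Require Import Reals Lra Lia List.
From Stdlib Require Import Classical ClassicalEpsilon FunctionalExtensionality.
From Coquelicot Require Import Coquelicot.
Open Scope R_scope.

(** Write [b = B F x(t_k)] for the input on a sampling interval.  The difficulty is
    that [b] lives in the extrapolation space [X'] only, while the solution must be
    continuous in [X].  It is resolved by one fact about [X']
    ([extrapolated_generator]): the generator [A'] of the extended semigroup is
    defined and bounded from [X] to [X'], and every [b] in [X'] can be written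
    [b = j w - A' (j v)] with [w], [v] in [X].  Indeed the resolvent of [A] turns
    the norm of [X'] into that of [X], so that difference quotients [(T(h) v - v)/h]
    converge in [X'], and [v |-> lambda (j v) - A' (j v)] is isometric with dense
    range.  Consequently
    [int_0^tau T'(s) b ds = j (int_0^tau T(s) w ds - (T(tau) v - v))]
    is a continuous path in [X] ([constant_input]).

    Since [j] is injective and intertwines the semigroups, the integral equation on
    one interval is then equivalent to a Volterra equation in [X],
    [u(tau) = T(tau) a + Phi(tau) + int_0^tau T(tau - s) phi(u(s)) ds],
    with [Phi] continuous and [phi] Lipschitz.  In the weighted norm
    [sup ||u(s)|| exp (- beta s)] its right-hand side is a contraction
    ([conv_contraction]), which gives existence and uniqueness on an interval of any
    length.  The intervals are glued one after the other ([glue]); as their lengths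
    are at least [tau_min], they exhaust the half-line.

    For the differential equation, the variation of constants formula restarted at
    [tau] shows that [j u] has the right derivative
    [A' (j (u tau)) + b + j (phi (u tau))] in [X'].  This is a continuous function of
    [tau], because [u] is continuous in [X] and [A' j] is bounded from [X] to [X'].
    A continuous function with a continuous right derivative is of class [C1], by a
    mean value inequality that only uses right increments ([increment_le]).

    The analysis is done over the reals, for [realify X] and [realify X'].  Local
    boundedness of the semigroups comes from [uniform_boundedness]. *)

(** * Linear identities in real modules *)

(** Reified linear combinations of a list of atoms: two of them are equal as soon
    as their real coefficients agree, which the tactic [ring] decides. *)

Inductive lin_expr : Type :=
  | LAtom (n : nat)
  | LZero
  | LPlus (e1 e2 : lin_expr)
  | LOpp (e : lin_expr)
  | LScal (a : R) (e : lin_expr).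

Fixpoint lin_eval {E : ModuleSpace R_Ring} (env : list E) (e : lin_expr) : E :=
  match e with
  | LAtom n => nth n env zero
  | LZero => zero
  | LPlus e1 e2 => plus (lin_eval env e1) (lin_eval env e2)
  | LOpp e => opp (lin_eval env e)
  | LScal a e => scal a (lin_eval env e)
  end.

Fixpoint lin_coef (e : lin_expr) (n : nat) : R :=
  match e with
  | LAtom m => if Nat.eqb n m then 1 else 0
  | LZero => 0
  | LPlus e1 e2 => lin_coef e1 n + lin_coef e2 n
  | LOpp e => - lin_coef e n
  | LScal a e => a * lin_coef e n
  end.

Fixpoint lin_comb {E : ModuleSpace R_Ring} (env : list E) (c : nat -> R) : E :=
  match env with
  | nil => zero
  | cons v env => plus (scal (c 0%nat) v) (lin_comb env (fun n => c (S n)))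
  end.

Fixpoint same_coefs (N : nat) (c d : nat -> R) : Prop :=
  match N with
  | 0%nat => True
  | S N => c 0%nat = d 0%nat /\ same_coefs N (fun n => c (S n)) (fun n => d (S n))
  end.

Section LinearIdentities.

Context {E : ModuleSpace R_Ring}.

Lemma lin_comb_ext (env : list E) (c d : nat -> R) :
  same_coefs (length env) c d -> lin_comb env c = lin_comb env d.
Proof.
  revert c d; induction env as [|v env IH]; simpl; intros c d H; [easy|].
  destruct H as [H0 H1]; rewrite H0, (IH _ _ H1); reflexivity.
Qed.

Lemma lin_comb_zero (env : list E) : lin_comb env (fun _ => 0) = zero.
Proof.
  induction env as [|v env IH]; simpl; [easy|].
  rewrite IH, plus_zero_r. exact (scal_zero_l v).
Qed.

Lemma lin_comb_plus (env : list E) (c d : nat -> R) :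
  lin_comb env (fun n => c n + d n) = plus (lin_comb env c) (lin_comb env d).
Proof.
  revert c d; induction env as [|v env IH]; simpl; intros c d.
  - now rewrite plus_zero_l.
  - rewrite (IH (fun n => c (S n)) (fun n => d (S n))).
    change (c 0%nat + d 0%nat) with (plus (c 0%nat) (d 0%nat)).
    rewrite (scal_distr_r (c 0%nat : R_Ring)), <- !plus_assoc.
    f_equal. rewrite !plus_assoc. f_equal. apply plus_comm.
Qed.

Lemma lin_comb_scal (env : list E) (a : R) (c : nat -> R) :
  lin_comb env (fun n => a * c n) = scal a (lin_comb env c).
Proof.
  revert c; induction env as [|v env IH]; simpl; intros c.
  - symmetry. exact (scal_zero_r (a : R_Ring)).
  - rewrite (IH (fun n => c (S n))), (scal_distr_l (a : R_Ring)).
    f_equal. symmetry. exact (scal_assoc (a : R_Ring) (c 0%nat) v).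
Qed.

Lemma lin_comb_atom (env : list E) (m : nat) :
  lin_comb env (fun n => if Nat.eqb n m then 1 else 0) = nth m env zero.
Proof.
  revert m; induction env as [|v env IH]; simpl; intros m.
  - now destruct m.
  - destruct m as [|m]; simpl.
    + rewrite lin_comb_zero, plus_zero_r. exact (scal_one v).
    + rewrite IH. change (plus (scal (@zero R_Ring) v) (nth m env zero) = nth m env zero).
      rewrite scal_zero_l. apply plus_zero_l.
Qed.

Lemma lin_eval_comb (env : list E) (e : lin_expr) :
  lin_eval env e = lin_comb env (lin_coef e).
Proof.
  induction e as [n| |e1 IH1 e2 IH2|e IH|a e IH]; simpl.
  - symmetry; apply lin_comb_atom.
  - symmetry; apply lin_comb_zero.
  - rewrite IH1, IH2. symmetry. exact (lin_comb_plus env (lin_coef e1) (lin_coef e2)).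
  - rewrite IH, <- (scal_opp_one (lin_comb env (lin_coef e))).
    transitivity (lin_comb env (fun n => -1 * lin_coef e n)).
    + symmetry. exact (lin_comb_scal env (-1) (lin_coef e)).
    + f_equal. apply functional_extensionality. intros n. ring.
  - rewrite IH. symmetry. apply (lin_comb_scal env a (lin_coef e)).
Qed.

Lemma lin_eval_eq (env : list E) (e1 e2 : lin_expr) :
  same_coefs (length env) (lin_coef e1) (lin_coef e2) ->
  lin_eval env e1 = lin_eval env e2.
Proof. intros H. rewrite !lin_eval_comb. now apply lin_comb_ext. Qed.

End LinearIdentities.

Ltac lin_index v env :=
  lazymatch env with
  | cons v _ => constr:(0%nat)
  | cons _ ?env' => let n := lin_index v env' in constr:(S n)
  end.

Ltac lin_add v env :=
  lazymatch env with
  | context [cons v _] => env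
  | _ => constr:(cons v env)
  end.

(* A scalar multiple is split only when the scalar is real; multiples by other
   scalars are atoms. *)
Ltac lin_atoms env e :=
  match e with
  | plus ?a ?b => let env := lin_atoms env a in lin_atoms env b
  | minus ?a ?b => let env := lin_atoms env a in lin_atoms env b
  | opp ?a => lin_atoms env a
  | scal ?r ?a => let _ := constr:(r : R) in lin_atoms env a
  | zero => env
  | ?v => lin_add v env
  end.

Ltac lin_reify env e :=
  match e with
  | plus ?a ?b =>
      let a := lin_reify env a in let b := lin_reify env b in constr:(LPlus a b)
  | minus ?a ?b =>
      let a := lin_reify env a in let b := lin_reify env b in
      constr:(LPlus a (LOpp b))
  | opp ?a => let a := lin_reify env a in constr:(LOpp a)
  | scal ?r ?a => let a := lin_reify env a in constr:(LScal r a)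
  | zero => constr:(LZero)
  | ?v => let n := lin_index v env in constr:(LAtom n)
  end.

(** Proves an equality between linear combinations in the real module [E] by
    comparing the coefficients of the atoms. *)
Ltac module_in E :=
  lazymatch goal with
  | |- ?l = ?r =>
      let env := lin_atoms (@nil E) l in
      let env := lin_atoms env r in
      let e1 := lin_reify env l in
      let e2 := lin_reify env r in
      refine (lin_eval_eq (E := E) env e1 e2 _);
      cbv [same_coefs lin_coef length Nat.eqb]; repeat split; try ring; try (field; lra)
  end.

(** * Calculus in real Banach spaces *)

(** The distance is taken in the normed module, so that it denotes the same
    term for normed modules and for complete ones. *)
Definition ndist {K : AbsRing} {W : NormedModule K} (x y : W) : R :=
  norm (minus x y).

Lemma filterlim_ndist {K : AbsRing} {W : NormedModule K} {I : Type}
    (G : (I -> Prop) -> Prop) (FG : Filter G) (f : I -> W) (y : W) :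
  filterlim f G (locally y) <->
  forall eps, 0 < eps -> G (fun i => ndist (f i) y < eps).
Proof.
  split; intros H.
  - intros eps He. exact (proj1 (filterlim_locally_ball_norm f y) H (mkposreal eps He)).
  - apply filterlim_locally_ball_norm. intros eps. apply H, cond_pos.
Qed.

Lemma locally_R_iff (s : R) (P : R -> Prop) :
  locally s P <-> exists d, 0 < d /\ forall r, Rabs (r - s) < d -> P r.
Proof.
  split.
  - intros [d Hd]. exists d. split; [apply cond_pos|]. intros r Hr. now apply Hd.
  - intros (d & Hd & H). exists (mkposreal d Hd). intros r Hr. now apply H.
Qed.

Lemma at_right_0_iff (P : R -> Prop) :
  at_right 0 P <-> exists d, 0 < d /\ forall h, 0 < h < d -> P h.
Proof.
  unfold at_right, within. rewrite locally_R_iff. split; intros (d & Hd & H).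
  - exists d. split; [easy|]. intros h Hh. apply H; [|lra].
    rewrite Rabs_pos_eq; lra.
  - exists d. split; [easy|]. intros r Hr Hr0. apply H.
    rewrite Rminus_0_r, Rabs_pos_eq in Hr; lra.
Qed.

Lemma continuous_R_iff {W : NormedModule R_AbsRing} (f : R -> W) (s : R) :
  continuous f s <->
  forall eps, 0 < eps -> exists d, 0 < d /\
    forall r, Rabs (r - s) < d -> ndist (f r) (f s) < eps.
Proof.
  etransitivity; [exact (filterlim_ndist (locally s) _ f (f s))|].
  split; intros H eps He; apply locally_R_iff; auto.
Qed.

Lemma norm_scal_real {W : NormedModule R_AbsRing} (a : R) (x : W) :
  norm (scal a x) = Rabs a * norm x.
Proof.
  apply Rle_antisym; [exact (norm_scal (a : R_AbsRing) x)|].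
  destruct (Req_dec a 0) as [->|Ha].
  - rewrite Rabs_R0, Rmult_0_l. apply norm_ge_0.
  - apply Rmult_le_reg_l with (/ Rabs a).
    + apply Rinv_0_lt_compat, Rabs_pos_lt, Ha.
    + rewrite <- Rmult_assoc, Rinv_l, Rmult_1_l by now apply Rabs_no_R0.
      assert (Hx : x = scal (/ a) (scal a x)) by module_in W.
      rewrite Hx at 1. rewrite <- Rabs_inv.
      exact (norm_scal (/ a : R_AbsRing) (scal a x)).
Qed.

Lemma minus_plus_cancel {G : AbelianGroup} (x y : G) : plus (minus x y) y = x.
Proof. unfold minus. now rewrite <- plus_assoc, plus_opp_l, plus_zero_r. Qed.

Lemma ndist_sym {K : AbsRing} {W : NormedModule K} (x y : W) :
  ndist x y = ndist y x.
Proof. unfold ndist. now rewrite <- norm_opp, opp_minus. Qed.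

Lemma ndist_triangle {K : AbsRing} {W : NormedModule K} (x y z : W) :
  ndist x z <= ndist x y + ndist y z.
Proof. unfold ndist. rewrite (minus_trans y x z). apply norm_triangle. Qed.

Lemma norm_le_ndist {K : AbsRing} {W : NormedModule K} (x y : W) :
  norm x <= ndist x y + norm y.
Proof.
  unfold ndist. rewrite <- (minus_plus_cancel x y) at 1. apply norm_triangle.
Qed.

Lemma ndist_le_norm {K : AbsRing} {W : NormedModule K} (x y : W) :
  ndist x y <= norm x + norm y.
Proof.
  unfold ndist, minus. rewrite <- (norm_opp y). apply norm_triangle.
Qed.

Lemma ndist_ge_0 {K : AbsRing} {W : NormedModule K} (x y : W) : 0 <= ndist x y.
Proof. apply norm_ge_0. Qed.

Lemma ndist_refl {K : AbsRing} {W : NormedModule K} (x : W) :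
  ndist x x = 0.
Proof. unfold ndist. rewrite (minus_eq_zero x). apply (norm_zero (V := W)). Qed.

Lemma ndist_eq_0 {K : AbsRing} {W : NormedModule K} (x y : W) :
  ndist x y = 0 -> x = y.
Proof.
  intros H. apply norm_eq_zero in H.
  apply (plus_reg_r (opp y)). rewrite plus_opp_r. exact H.
Qed.

Lemma ndist_quotient {W : NormedModule R_AbsRing} (h : R) (z y : W) :
  0 < h -> ndist z (scal h y) = h * ndist (scal (/ h) z) y.
Proof.
  intros Hh. unfold ndist. rewrite <- (Rabs_pos_eq h) at 2 by lra.
  rewrite <- norm_scal_real. f_equal. module_in W.
Qed.

(** A version of the mean value inequality that only looks to the right of each
    point: the largest interval [[a, c]] on which the bound holds cannot end
    before [b], since the hypothesis at [c] would extend it. *)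
Lemma increment_le {W : NormedModule R_AbsRing} (u : R -> W) (a b M : R) :
  a <= b ->
  (forall s, a <= s <= b -> continuous u s) ->
  (forall s, a <= s < b ->
     at_right 0 (fun h => ndist (u (s + h)) (u s) <= M * h)) ->
  ndist (u b) (u a) <= M * (b - a).
Proof.
  intros Hab Hc Hr.
  destruct Hab as [Hab| ->].
  2: { rewrite ndist_refl. lra. }
  assert (HM : 0 <= M).
  { destruct (proj1 (at_right_0_iff _) (Hr a ltac:(lra))) as (d & Hd & H).
    specialize (H (d / 2) ltac:(lra)).
    generalize (ndist_ge_0 (u (a + d / 2)) (u a)); intros. nra. }
  pose (P := fun s => a <= s <= b /\
    forall r, a <= r <= s -> ndist (u r) (u a) <= M * (r - a)).
  assert (Pa : P a).
  { split; [lra|]. intros r H. replace r with a by lra.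
    rewrite ndist_refl. lra. }
  destruct (completeness P) as [c [Hub Hlub]].
  { exists b. intros s [Hs _]. lra. }
  { now exists a. }
  assert (Hca : a <= c) by now apply Hub.
  assert (Hcb : c <= b) by (apply Hlub; intros s [Hs _]; lra).
  assert (Hbelow : forall r, a <= r < c -> ndist (u r) (u a) <= M * (r - a)).
  { intros r H. apply NNPP. intros Hn.
    assert (c <= r); [|lra]. apply Hlub. intros s [Hs HP].
    apply Rnot_lt_le. intros Hrs. apply Hn, HP. lra. }
  assert (Hatc : ndist (u c) (u a) <= M * (c - a)).
  { destruct (Req_dec a c) as [<-|Hne]; [apply Pa; lra|].
    apply le_epsilon. intros eps He.
    destruct (proj1 (continuous_R_iff u c) (Hc c ltac:(lra)) eps He) as (d & Hd & H).
    pose (r := Rmax a (c - d / 2)).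
    assert (Hr1 : a <= r < c /\ Rabs (r - c) < d).
    { unfold r, Rmax, Rabs. destruct (Rle_dec a (c - d / 2)), (Rcase_abs _); lra. }
    destruct Hr1 as [Hr1 Hr2].
    specialize (Hbelow r Hr1). specialize (H r Hr2). rewrite ndist_sym in H.
    generalize (ndist_triangle (u c) (u r) (u a)). nra. }
  assert (Pc : P c).
  { split; [lra|]. intros r H. destruct (Req_dec r c) as [->|]; [easy|].
    apply Hbelow. lra. }
  destruct (Req_dec c b) as [->|Hne]; [easy|].
  destruct (proj1 (at_right_0_iff _) (Hr c ltac:(lra))) as (d & Hd & H).
  pose (e := Rmin (d / 2) (b - c)).
  assert (He : 0 < e /\ e < d /\ c + e <= b).
  { unfold e, Rmin. destruct (Rle_dec _ _); lra. }
  assert (P (c + e)).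
  { split; [lra|]. intros r Hr1. destruct (Rle_lt_dec r c) as [Hrc|Hrc].
    - apply Pc. lra.
    - specialize (H (r - c) ltac:(lra)). replace (c + (r - c)) with r in H by ring.
      generalize (ndist_triangle (u r) (u c) (u a)). nra. }
  assert (c + e <= c) by now apply Hub. lra.
Qed.

(** ** Bounded linear maps and integrals *)

Lemma linear_zero {K : AbsRing} {V W : NormedModule K} (l : V -> W) :
  is_linear l -> l zero = zero.
Proof.
  intros Hl. transitivity (l (scal (zero : K) (zero : V))).
  - f_equal. symmetry. apply @scal_zero_l.
  - rewrite (linear_scal l Hl). apply @scal_zero_l.
Qed.

Lemma linear_minus {K : AbsRing} {V W : NormedModule K} (l : V -> W) (x y : V) :
  is_linear l -> l (minus x y) = minus (l x) (l y).
Proof.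
  intros Hl. apply (plus_reg_r (l y)).
  etransitivity; [symmetry; apply (linear_plus l Hl)|].
  etransitivity; [exact (f_equal l (minus_plus_cancel x y))|].
  symmetry. apply @minus_plus_cancel.
Qed.

Lemma ndist_linear_zero {K : AbsRing} {V W : NormedModule K} (l : V -> W) (y : W) :
  is_linear l -> ndist (l zero) y = norm y.
Proof.
  intros Hl. rewrite (linear_zero l Hl), ndist_sym. unfold ndist. f_equal.
  apply @minus_zero_r.
Qed.

Lemma linear_filterlim {K : AbsRing} {V W : NormedModule K} {I : Type}
    (G : (I -> Prop) -> Prop) (FG : Filter G) (l : V -> W) (f : I -> V) (y : V) :
  is_linear l -> filterlim f G (locally y) ->
  filterlim (fun i => l (f i)) G (locally (l y)).
Proof.
  intros Hl Hf. apply (filterlim_comp _ _ _ f l G (locally y)); [easy|].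
  apply (linear_cont l y Hl).
Qed.

Lemma is_RInt_linear {V W : NormedModule R_AbsRing} (l : V -> W) (f : R -> V)
    (a b : R) (v : V) :
  is_linear l -> is_RInt f a b v -> is_RInt (fun s => l (f s)) a b (l v).
Proof.
  intros Hl Hf. unfold is_RInt.
  apply filterlim_ext with
    (fun ptd => l (scal (sign (b - a)) (Riemann_sum f ptd))).
  - intros ptd. rewrite (linear_scal l Hl). f_equal.
    induction ptd as [h|h s IH] using SF_cons_ind.
    + apply (linear_zero l Hl).
    + rewrite !Riemann_sum_cons, (linear_plus l Hl), (linear_scal l Hl), IH.
      reflexivity.
  - apply linear_filterlim; [apply Riemann_fine_filter|easy|easy].
Qed.

Lemma is_RInt_const_minus {W : NormedModule R_AbsRing} (f : R -> W) (h : R) (v I : W) (eps : R) :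
  0 <= h ->
  (forall s, 0 <= s <= h -> ndist (f s) v <= eps) ->
  is_RInt f 0 h I -> ndist I (scal h v) <= eps * h.
Proof.
  intros Hh Hf HI. replace (eps * h) with ((h - 0) * eps) by ring.
  unfold ndist. apply (norm_RInt_le_const (fun s => minus (f s) v) 0 h); [easy|easy|].
  apply is_RInt_minus; [easy|].
  generalize (is_RInt_const 0 h v). now rewrite Rminus_0_r.
Qed.

(** ** Limits of sequences *)

Lemma filterlim_seq_iff {K : AbsRing} {W : NormedModule K} (u : nat -> W) (l : W) :
  filterlim u eventually (locally l) <->
  forall eps, 0 < eps -> exists N, forall n, (N <= n)%nat -> ndist (u n) l < eps.
Proof. rewrite filterlim_ndist by apply filter_filter. reflexivity. Qed.

Lemma cauchy_seq_cv {K : AbsRing} {W : CompleteNormedModule K} (u : nat -> W) :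
  (forall eps, 0 < eps -> exists N, forall n m, (N <= n)%nat -> (N <= m)%nat ->
     ndist (u n) (u m) < eps) ->
  exists l : W, filterlim u eventually (locally l).
Proof.
  intros H. apply (proj1 (filterlim_locally_cauchy u)). intros eps.
  destruct (H eps (cond_pos eps)) as [N HN].
  exists (fun n => (N <= n)%nat). split; [now exists N|].
  intros n m Hn Hm. apply (norm_compat1 (V := W)), HN; easy.
Qed.

Lemma limit_norm_le {K : AbsRing} {W : NormedModule K} (u : nat -> W) (l y : W) (c : R) (N : nat) :
  filterlim u eventually (locally l) ->
  (forall n, (N <= n)%nat -> ndist (u n) y <= c) -> ndist l y <= c.
Proof.
  intros Hu Hc. apply le_epsilon. intros eps He.
  destruct (proj1 (filterlim_seq_iff u l) Hu eps He) as [N' H].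
  specialize (H (max N N') ltac:(lia)). specialize (Hc (max N N') ltac:(lia)).
  rewrite ndist_sym in H.
  generalize (ndist_triangle l (u (max N N')) y). lra.
Qed.

Lemma controlled_seq_cv {K : AbsRing} {W : CompleteNormedModule K} (u : nat -> W) (r : nat -> R) :
  (forall n m, (n <= m)%nat -> ndist (u m) (u n) <= r n) ->
  (forall eps, 0 < eps -> exists N, r N < eps) ->
  exists l : W, filterlim u eventually (locally l) /\
    forall n, ndist l (u n) <= r n.
Proof.
  intros Hu Hr. destruct (cauchy_seq_cv u) as [l Hl].
  - intros eps He. destruct (Hr (eps / 2)) as [N HN]; [lra|].
    exists N. intros n m Hn Hm.
    generalize (ndist_triangle (u n) (u N) (u m)), (Hu N n Hn), (Hu N m Hm).
    rewrite (ndist_sym (u N) (u m)). lra.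
  - exists l. split; [easy|]. intros n. apply limit_norm_le with u n; auto.
Qed.

(** * Uniform boundedness *)

(** The step of the gliding hump: a vector on which some [T i] is much larger
    than its norm, added to or subtracted from [x], makes [T i] large on a whole
    ball near [x]. *)
Lemma unbounded_family_step {V W : NormedModule R_AbsRing} {I : Type}
    (T : I -> V -> W) (N r : R) (x : V) :
  (forall i, is_linear (T i)) ->
  ~ (exists M, 0 < M /\ forall i x, norm (T i x) <= M * norm x) ->
  0 <= N -> 0 < r ->
  exists (y : V) (r' : R), 0 < r' <= r / 2 /\ ndist y x <= r / 2 /\
    exists i, forall z, ndist z y <= r' -> N <= norm (T i z).
Proof.
  intros HT Hn HN Hr.
  assert (exists i z, 2 * (N + 1) / r * norm z < norm (T i z)) as (i & z & Hz).
  { apply NNPP. intros H. apply Hn. exists (2 * (N + 1) / r). split.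
    - apply Rdiv_lt_0_compat; lra.
    - intros i z. apply Rnot_lt_le. intros Hlt. apply H. now exists i, z. }
  assert (Hz0 : 0 < norm z).
  { destruct (norm_ge_0 z) as [H|H]; [easy|].
    destruct (linear_norm _ (HT i)) as (M & HM & Hb).
    specialize (Hb z). rewrite <- H in Hz, Hb. lra. }
  pose (xi := scal (r / (2 * norm z)) z).
  assert (Hxi : norm xi = r / 2).
  { unfold xi. rewrite norm_scal_real, Rabs_pos_eq.
    - field. lra.
    - apply Rlt_le, Rdiv_lt_0_compat; lra. }
  assert (HTxi : N + 1 <= norm (T i xi)).
  { unfold xi. rewrite (linear_scal _ (HT i)), norm_scal_real, Rabs_pos_eq
      by (apply Rlt_le, Rdiv_lt_0_compat; lra).
    apply Rle_trans with (r / (2 * norm z) * (2 * (N + 1) / r * norm z)).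
    - right. field. lra.
    - apply Rmult_le_compat_l; [apply Rlt_le, Rdiv_lt_0_compat|]; lra. }
  assert (exists y, ndist y x <= r / 2 /\ N + 1 <= norm (T i y)) as (y & Hy & HTy).
  { destruct (Rle_lt_dec (N + 1) (norm (T i (plus x xi)))) as [H|H].
    - exists (plus x xi). split; [|easy]. unfold ndist.
      replace (minus (plus x xi) x) with xi by module_in V. lra.
    - exists (minus x xi). split.
      + unfold ndist. replace (minus (minus x xi) x) with (opp xi) by module_in V.
        apply Rle_trans with (norm xi); [right; apply @norm_opp|lra].
      + (* One of [T (x + xi)], [T (x - xi)] is at least as large as [T xi]. *)
        assert (E : scal 2 (T i xi) = minus (T i (plus x xi)) (T i (minus x xi))).
        { rewrite (linear_minus _ _ _ (HT i)), (linear_plus _ (HT i)). module_in W. }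
        apply (f_equal norm) in E. rewrite norm_scal_real, Rabs_pos_eq in E by lra.
        generalize (ndist_le_norm (T i (plus x xi)) (T i (minus x xi))).
        unfold ndist. lra. }
  destruct (linear_norm _ (HT i)) as (M & HM & Hb).
  (* On a ball of radius [1 / M] about [y] the value of [T i] varies by at most 1. *)
  exists y, (Rmin (r / 2) (/ M)). split; [|split; [easy|]].
  - split; [|apply Rmin_l]. apply Rmin_glb_lt; [lra|now apply Rinv_0_lt_compat].
  - exists i. intros w Hw. specialize (Hb (minus y w)).
    rewrite (linear_minus _ _ _ (HT i)) in Hb. fold (ndist (T i y) (T i w)) in Hb.
    assert (M * norm (minus y w) <= 1).
    { rewrite ndist_sym in Hw. unfold ndist in Hw.
      apply Rle_trans with (M * / M); [|right; field; lra].
      apply Rmult_le_compat_l; [lra|]. eapply Rle_trans; [exact Hw|apply Rmin_r]. }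
    generalize (norm_le_ndist (T i y) (T i w)). lra.
Qed.

(** If the family were unbounded, iterating the step would produce nested balls
    on the [n]th of which some [T i] is at least [n]; at their common point the
    family would be unbounded. *)
Theorem uniform_boundedness {V : CompleteNormedModule R_AbsRing}
    {W : NormedModule R_AbsRing} {I : Type} (T : I -> V -> W) :
  (forall i, is_linear (T i)) ->
  (forall x, exists M, forall i, norm (T i x) <= M) ->
  exists M, 0 < M /\ forall i x, norm (T i x) <= M * norm x.
Proof.
  intros HT Hpt. apply NNPP. intros Hn.
  assert (step : forall (n : nat) (p : {q : V * R | 0 < snd q}),
    exists q : {q : V * R | 0 < snd q},
      snd (proj1_sig q) <= snd (proj1_sig p) / 2 /\
      ndist (fst (proj1_sig q)) (fst (proj1_sig p)) <= snd (proj1_sig p) / 2 /\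
      exists i, forall z, ndist z (fst (proj1_sig q)) <= snd (proj1_sig q) ->
        INR n <= norm (T i z)).
  { intros n [[x r] Hr]. simpl in *.
    destruct (unbounded_family_step T (INR n) r x HT Hn (pos_INR n) Hr)
      as (y & r' & Hr' & Hy & H).
    exists (exist (fun q : V * R => 0 < snd q) (y, r') (proj1 Hr')). simpl. tauto. }
  pose (next := fun n p => proj1_sig (constructive_indefinite_description _ (step n p))).
  pose (s := fix s (n : nat) : {q : V * R | 0 < snd q} :=
    match n with
    | 0%nat => exist (fun q : V * R => 0 < snd q) (zero, 1) Rlt_0_1
    | S n => next n (s n)
    end).
  pose (x := fun n => fst (proj1_sig (s n))).
  pose (r := fun n => snd (proj1_sig (s n))).
  assert (Hs : forall n, r (S n) <= r n / 2 /\ ndist (x (S n)) (x n) <= r n / 2 /\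
      exists i, forall z, ndist z (x (S n)) <= r (S n) -> INR n <= norm (T i z)).
  { intros n. unfold r, x. simpl. unfold next.
    destruct (constructive_indefinite_description _ (step n (s n))) as [q Hq].
    exact Hq. }
  assert (Hr0 : forall n, 0 < r n) by (intros n; unfold r; apply (proj2_sig (s n))).
  destruct (controlled_seq_cv x r) as (l & _ & Hl).
  - intros n m Hnm.
    assert (ndist (x m) (x n) <= r n - r m).
    { induction Hnm as [|m Hnm IH]; [rewrite ndist_refl; lra|].
      destruct (Hs m) as (H1 & H2 & _).
      generalize (ndist_triangle (x (S m)) (x m) (x n)). lra. }
    specialize (Hr0 m). lra.
  - assert (Hgeo : forall n, r n <= (/ 2) ^ n).
    { induction n as [|n IH]; [unfold r; simpl; lra|].
      destruct (Hs n) as (H1 & _). simpl. lra. }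
    intros eps He. destruct (pow_lt_1_zero (/ 2)) with (y := eps) as [N HN];
      [rewrite Rabs_pos_eq; lra|easy|].
    exists N. specialize (HN N (le_n N)). rewrite Rabs_pos_eq in HN.
    + specialize (Hgeo N). lra.
    + apply pow_le. lra.
  - destruct (Hpt l) as [M HM]. destruct (INR_archimed 1 M) as [n Hn']; [lra|].
    destruct (Hs n) as (_ & _ & i & Hi). specialize (HM i).
    specialize (Hi l (Hl (S n))). lra.
Qed.

(** * Strongly continuous semigroups *)

Section Semigroup.

Context {E : CompleteNormedModule R_AbsRing} (T : R -> E -> E).
Hypothesis HT : C0_semigroup (k := real_scalars) T.

Let T_linear (t : R) (Ht : 0 <= t) : is_linear (T t) :=
  semigroup_bounded (k := real_scalars) T HT t Ht.
Let T_0 (x : E) : T 0 x = x := semigroup_0 (k := real_scalars) T HT x.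
Let T_plus (s t : R) (x : E) (Hs : 0 <= s) (Ht : 0 <= t) :
  T (s + t) x = T s (T t x) := semigroup_plus (k := real_scalars) T HT s t x Hs Ht.
Let T_cont (x : E) : filterlim (fun h => T h x) (at_right 0) (locally x) :=
  semigroup_cont (k := real_scalars) T HT x.

(** Freezing the semigroup at its value at time [0] for negative times makes all
    its orbits continuous on the whole line, which spares one-sided limits. *)
Definition frozen (t : R) (x : E) : E := T (Rmax 0 t) x.

Lemma frozen_linear (t : R) : is_linear (frozen t).
Proof. apply (T_linear). apply Rmax_l. Qed.

Lemma frozen_eq (t : R) (x : E) : 0 <= t -> frozen t x = T t x.
Proof. intros H. unfold frozen. now rewrite Rmax_right. Qed.

Lemma frozen_0 (x : E) : frozen 0 x = x.
Proof. rewrite frozen_eq by lra. apply (T_0). Qed.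

Lemma frozen_plus (s t : R) (x : E) :
  0 <= s -> 0 <= t -> frozen (s + t) x = frozen s (frozen t x).
Proof. intros Hs Ht. rewrite !frozen_eq by lra. now apply (T_plus). Qed.

(** Otherwise there would be times [t_n -> 0] with [||T(t_n)||] unbounded,
    although [T(t_n) x] converges for every [x]. *)
Lemma semigroup_bounded_near_0 :
  exists d M, 0 < d /\ 0 < M /\ forall t x, 0 <= t <= d -> norm (T t x) <= M * norm x.
Proof.
  apply NNPP. intros Hn.
  assert (H : forall n : nat, exists t, 0 <= t <= / INR (S n) /\
     exists x, INR (S n) * norm x < norm (T t x)).
  { intros n. apply NNPP. intros H. apply Hn.
    assert (0 < INR (S n)) by apply lt_0_INR, Nat.lt_0_succ.
    exists (/ INR (S n)), (INR (S n)).
    split; [now apply Rinv_0_lt_compat|]. split; [easy|]. intros t x Ht.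
    apply Rnot_lt_le. intros Hlt. apply H. exists t. split; [easy|]. now exists x. }
  pose (tt := fun n => proj1_sig (constructive_indefinite_description _ (H n))).
  assert (Htt : forall n, 0 <= tt n <= / INR (S n) /\
     exists x, INR (S n) * norm x < norm (T (tt n) x)).
  { intros n. unfold tt. now destruct (constructive_indefinite_description _ (H n)). }
  destruct (uniform_boundedness (fun n => T (tt n))) as (M & HM & HB).
  - intros n. apply (T_linear), Htt.
  - intros x.
    assert (exists d, 0 < d /\ forall h, 0 <= h < d -> norm (T h x) <= 1 + norm x)
      as (d & Hd & Hx).
    { generalize (T_cont x). intros Hc.
      destruct (proj1 (at_right_0_iff _)
        (proj1 (filterlim_ndist (at_right 0) _ _ _) Hc 1 Rlt_0_1)) as (d & Hd & Hh).
      exists d. split; [easy|]. intros h Hh0.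
      generalize (norm_le_ndist (T h x) x). destruct (Req_dec h 0) as [->|Hne].
      - rewrite (T_0). lra.
      - specialize (Hh h ltac:(lra)). lra. }
    assert (HN : exists N, forall n, (N <= n)%nat -> tt n < d).
    { destruct (INR_archimed 1 (/ d)) as [N HN]; [lra|]. rewrite Rmult_1_r in HN.
      exists N. intros n Hn'. apply Rle_lt_trans with (/ INR (S n)); [apply Htt|].
      rewrite <- (Rinv_inv d). apply Rinv_lt_contravar.
      - apply Rmult_lt_0_compat; [now apply Rinv_0_lt_compat|].
        apply lt_0_INR, Nat.lt_0_succ.
      - apply Rlt_le_trans with (INR N); [easy|]. apply le_INR. lia. }
    destruct HN as [N HN].
    assert (Hfin : exists B, forall n, (n < N)%nat -> norm (T (tt n) x) <= B).
    { clear. induction N as [|N [B HB]]; [exists 0; lia|].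
      exists (Rmax B (norm (T (tt N) x))). intros n Hn.
      destruct (Nat.eq_dec n N) as [->|]; [apply Rmax_r|].
      eapply Rle_trans; [apply HB; lia|apply Rmax_l]. }
    destruct Hfin as [B HB]. exists (Rmax B (1 + norm x)). intros n.
    destruct (Nat.lt_ge_cases n N) as [Hlt|Hge].
    + eapply Rle_trans; [now apply HB|apply Rmax_l].
    + eapply Rle_trans; [|apply Rmax_r]. apply Hx. split; [apply Htt|now apply HN].
  - destruct (INR_archimed 1 M) as [n Hn']; [lra|]. rewrite Rmult_1_r in Hn'.
    destruct (Htt n) as (_ & x & Hx). specialize (HB n x).
    rewrite S_INR in Hx. generalize (norm_ge_0 x). nra.
Qed.

Lemma frozen_bounded (K : R) :
  exists M, 0 < M /\ forall t x, t <= K -> norm (frozen t x) <= M * norm x.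
Proof.
  destruct semigroup_bounded_near_0 as (d & M & Hd & HM & HB).
  assert (H : forall n : nat, exists C, 0 < C /\
    forall t x, t <= INR n * d -> norm (frozen t x) <= C * norm x).
  { induction n as [|n (C & HC & IH)].
    - exists 1. split; [lra|]. intros t x Ht. rewrite Rmult_0_l in Ht.
      unfold frozen. rewrite Rmax_left, (T_0); lra.
    - exists (Rmax C (M * C)). split; [apply Rlt_le_trans with C; [easy|apply Rmax_l]|].
      intros t x Ht. destruct (Rle_lt_dec t (INR n * d)) as [Hle|Hlt].
      + eapply Rle_trans; [now apply IH|].
        apply Rmult_le_compat_r; [apply norm_ge_0|apply Rmax_l].
      + rewrite S_INR in Ht.
        assert (0 <= INR n * d) by (apply Rmult_le_pos; [apply pos_INR|lra]).
        replace t with ((t - INR n * d) + INR n * d) by ring.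
        rewrite frozen_plus by lra. rewrite frozen_eq by lra.
        eapply Rle_trans; [apply HB; lra|].
        apply Rle_trans with (M * C * norm x).
        * rewrite Rmult_assoc. apply Rmult_le_compat_l; [lra|]. apply IH. lra.
        * apply Rmult_le_compat_r; [apply norm_ge_0|apply Rmax_r]. }
  destruct (INR_archimed d K Hd) as [n Hn].
  destruct (H n) as (C & HC & HCb). exists C. split; [easy|].
  intros t x Ht. apply HCb. lra.
Qed.

Lemma frozen_ndist (M t : R) (x y : E) :
  (forall z, norm (frozen t z) <= M * norm z) ->
  ndist (frozen t x) (frozen t y) <= M * ndist x y.
Proof.
  intros H. unfold ndist.
  rewrite <- (linear_minus _ x y (frozen_linear t)). apply H.
Qed.

(** To the left of [s] the bound on the operators is needed:
    [T(s) x - T(r) x = T(r) (T(s-r) x - x)]. *)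
Lemma frozen_orbit_continuous (x : E) (s : R) : continuous (fun t => frozen t x) s.
Proof.
  refine (proj2 (continuous_R_iff (W := E) _ s) _). intros eps He.
  destruct (frozen_bounded (s + 1)) as (M & HM & HB).
  destruct (proj1 (at_right_0_iff _) (proj1 (filterlim_ndist (at_right 0) _ _ _)
     (T_cont x) (eps / M) (Rdiv_lt_0_compat _ _ He HM))) as (d & Hd & Hx).
  assert (key : forall a b, 0 <= a -> b <= s + 1 -> 0 <= b - a < d ->
     ndist (frozen b x) (frozen a x) < eps).
  { intros a b Ha Hb Hab. destruct (Req_dec a b) as [->|Hne]; [rewrite ndist_refl; lra|].
    replace b with (a + (b - a)) at 1 by ring. rewrite frozen_plus by lra.
    eapply Rle_lt_trans; [apply (frozen_ndist M); intros z; apply HB; lra|].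
    rewrite frozen_eq by lra.
    apply Rlt_le_trans with (M * (eps / M)); [|right; field; lra].
    apply Rmult_lt_compat_l; [easy|]. apply Hx. lra. }
  assert (Hfr : forall t, frozen t x = frozen (Rmax 0 t) x).
  { intros t. unfold frozen. now rewrite (Rmax_right 0 (Rmax 0 t)) by apply Rmax_l. }
  destruct (Rle_lt_dec (s + 1) 0) as [Hs|Hs].
  { exists 1. split; [lra|]. intros r Hr. apply Rabs_lt_between' in Hr.
    rewrite (Hfr r), (Hfr s), !Rmax_left, ndist_refl by lra. easy. }
  exists (Rmin d 1). split; [apply Rmin_glb_lt; lra|]. intros r Hr.
  assert (Hr1 : Rabs (r - s) < d) by (eapply Rlt_le_trans; [exact Hr|apply Rmin_l]).
  assert (Hr2 : Rabs (r - s) < 1) by (eapply Rlt_le_trans; [exact Hr|apply Rmin_r]).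
  apply Rabs_lt_between' in Hr1. apply Rabs_lt_between' in Hr2.
  rewrite (Hfr r), (Hfr s).
  destruct (Rle_lt_dec s r) as [Hsr|Hsr].
  - apply key; unfold Rmax; repeat destruct (Rle_dec _ _); lra.
  - rewrite ndist_sym. apply key; unfold Rmax; repeat destruct (Rle_dec _ _); lra.
Qed.

(** The local bound turns the continuity of the orbits into joint continuity. *)
Lemma frozen_continuous (p : R -> R) (f : R -> E) (s : R) :
  continuous p s -> continuous f s -> continuous (fun t => frozen (p t) (f t)) s.
Proof.
  intros Hp Hf. refine (proj2 (continuous_R_iff (W := E) _ s) _). intros eps He.
  destruct (frozen_bounded (p s + 1)) as (M & HM & HB).
  destruct (proj1 (continuous_R_iff (W := E) f s) Hf (eps / 2 / M)) as (d1 & Hd1 & H1).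
  { apply Rdiv_lt_0_compat; lra. }
  destruct (proj1 (continuous_R_iff (W := E) _ s)
    (continuous_comp p (fun t => frozen t (f s)) s Hp (frozen_orbit_continuous _ _))
    (eps / 2)) as (d2 & Hd2 & H2); [lra|].
  destruct (proj1 (continuous_R_iff (W := R_NormedModule) p s) Hp 1 Rlt_0_1)
    as (d3 & Hd3 & H3).
  exists (Rmin d1 (Rmin d2 d3)).
  split; [repeat apply Rmin_glb_lt; lra|]. intros r Hr.
  apply Rmin_Rgt in Hr. destruct Hr as [Hr1 Hr]. apply Rmin_Rgt in Hr.
  destruct Hr as [Hr2 Hr3].
  specialize (H1 r Hr1). specialize (H2 r Hr2). specialize (H3 r Hr3).
  assert (Hp1 : p r <= p s + 1).
  { change (Rabs (p r - p s) < 1) in H3. apply Rabs_lt_between' in H3. lra. }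
  generalize (ndist_triangle (frozen (p r) (f r)) (frozen (p r) (f s)) (frozen (p s) (f s))).
  assert (ndist (frozen (p r) (f r)) (frozen (p r) (f s)) < eps / 2); [|lra].
  eapply Rle_lt_trans; [apply (frozen_ndist M); intros z; now apply HB|].
  apply Rlt_le_trans with (M * (eps / 2 / M)); [|right; field; lra].
  now apply Rmult_lt_compat_l.
Qed.

End Semigroup.

(** * Convolution with a semigroup *)

Section Convolution.

Context {E : CompleteNormedModule R_AbsRing} (T : R -> E -> E).
Hypothesis HT : C0_semigroup (k := real_scalars) T.

(** The Duhamel term of the variation of constants formula. *)
Definition conv (w : R -> E) (tau : R) : E :=
  RInt (fun s => frozen T (tau - s) (w s)) 0 tau.

Lemma kernel_continuous (w : R -> E) (tau s : R) :
  continuous w s -> continuous (fun s => frozen T (tau - s) (w s)) s.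
Proof.
  intros Hw. apply (frozen_continuous T HT (fun s => tau - s)); [|easy].
  apply (continuous_minus (V := R_NormedModule) (fun _ => tau) (fun s => s)).
  - apply continuous_const.
  - apply continuous_id.
Qed.

Lemma conv_correct (w : R -> E) (tau : R) :
  (forall s, continuous w s) ->
  is_RInt (fun s => frozen T (tau - s) (w s)) 0 tau (conv w tau).
Proof.
  intros Hw. apply (RInt_correct (V := E)), (ex_RInt_continuous (V := E)).
  intros s _. now apply kernel_continuous.
Qed.

Lemma conv_unique (w : R -> E) (tau : R) (I : E) :
  is_RInt (fun s => frozen T (tau - s) (w s)) 0 tau I -> conv w tau = I.
Proof. apply (is_RInt_unique (V := E)). Qed.

Lemma conv_0 (w : R -> E) : conv w 0 = zero.
Proof. apply conv_unique. apply (is_RInt_point (V := E)). Qed.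

Lemma conv_ext (w1 w2 : R -> E) (tau : R) :
  0 <= tau -> (forall s, 0 < s < tau -> w1 s = w2 s) -> conv w1 tau = conv w2 tau.
Proof.
  intros Ht H. apply (RInt_ext (V := E)). intros s Hs.
  rewrite Rmin_left, Rmax_right in Hs by lra. now rewrite H.
Qed.

Lemma conv_plus (w1 w2 : R -> E) (tau : R) :
  (forall s, continuous w1 s) -> (forall s, continuous w2 s) ->
  conv (fun s => plus (w1 s) (w2 s)) tau = plus (conv w1 tau) (conv w2 tau).
Proof.
  intros H1 H2. apply conv_unique.
  apply is_RInt_ext with
    (fun s => plus (frozen T (tau - s) (w1 s)) (frozen T (tau - s) (w2 s))).
  - intros s _. symmetry. apply (linear_plus _ (frozen_linear T HT _)).
  - apply (is_RInt_plus (V := E)); now apply conv_correct.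
Qed.

Lemma conv_flip (w : R -> E) (tau : R) :
  (forall s, continuous w s) ->
  is_RInt (fun s => frozen T s (w (tau - s))) 0 tau (conv w tau).
Proof.
  intros Hw.
  assert (H : is_RInt (fun s => frozen T (tau - s) (w s))
    (-1 * tau + tau) (-1 * 0 + tau) (conv w tau)).
  { replace (-1 * tau + tau) with 0 by ring. replace (-1 * 0 + tau) with tau by ring.
    now apply conv_correct. }
  apply is_RInt_comp_lin, (is_RInt_swap (V := E)), (is_RInt_opp (V := E)) in H.
  rewrite opp_opp in H. revert H. apply is_RInt_ext. intros s _.
  replace (tau - (-1 * s + tau)) with s by ring.
  replace (-1 * s + tau) with (tau - s) by ring. module_in E.
Qed.

(** After the substitution [s := tau - s] the dependence on [tau] sits in [w],
    which is uniformly continuous on bounded intervals. *)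
Lemma conv_continuous (w : R -> E) (tau : R) :
  (forall s, continuous w s) -> continuous (conv w) tau.
Proof.
  intros Hw. refine (proj2 (continuous_R_iff (W := E) _ tau) _). intros eps He.
  pose (K := Rabs tau + 1).
  assert (HK : 1 <= K) by (unfold K; generalize (Rabs_pos tau); lra).
  destruct (frozen_bounded T HT K) as (M & HM & HB).
  assert (Hbw : exists C, 0 < C /\ forall s, - (2 * K) <= s <= 2 * K -> norm (w s) <= C).
  { destruct (continuity_ab_maj (fun s => norm (w s)) (- (2 * K)) (2 * K))
      as (m & Hm & _); [lra| |].
    - intros s _. apply continuity_pt_filterlim.
      apply (continuous_comp w norm); [apply Hw|apply (filterlim_norm (V := E))].
    - exists (Rmax 1 (norm (w m))). split; [eapply Rlt_le_trans; [apply Rlt_0_1|apply Rmax_l]|].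
      intros s Hs. eapply Rle_trans; [now apply Hm|apply Rmax_r]. }
  destruct Hbw as (C & HC & HCb).
  assert (He' : 0 < eps / (4 * K * M)) by (apply Rdiv_lt_0_compat; nra).
  destruct (unifcont_normed_1d w (- (2 * K)) (2 * K) (fun s _ => Hw s) (mkposreal _ He'))
    as [d Hd].
  exists (Rmin 1 (Rmin d (eps / (4 * M * C)))).
  assert (He2 : 0 < eps / (4 * M * C)) by (apply Rdiv_lt_0_compat; nra).
  split; [repeat apply Rmin_glb_lt; [lra|apply cond_pos|easy]|].
  intros r Hr. apply Rmin_Rgt in Hr. destruct Hr as [Hr1 Hr].
  apply Rmin_Rgt in Hr. destruct Hr as [Hr2 Hr3].
  apply Rgt_lt in Hr1, Hr2, Hr3.
  assert (Htau : - K <= tau <= K /\ - K <= r <= K).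
  { unfold K. unfold Rabs in *. repeat destruct (Rcase_abs _); lra. }
  assert (Hin : forall t, is_RInt (fun s => frozen T s (w (t - s))) 0 t (conv w t))
    by (intros t; now apply conv_flip).
  assert (Hcont : forall t s, continuous (fun s => frozen T s (w (t - s))) s).
  { intros t s. apply (frozen_continuous T HT (fun s => s)); [apply continuous_id|].
    apply (continuous_comp (fun s => t - s) w); [|apply Hw].
    apply (continuous_minus (V := R_NormedModule) (fun _ => t) (fun s => s));
      [apply continuous_const|apply continuous_id]. }
  pose (I2 := RInt (fun s => frozen T s (w (r - s))) tau r).
  assert (H2 : is_RInt (fun s => frozen T s (w (r - s))) tau r I2).
  { apply (RInt_correct (V := E)), (ex_RInt_continuous (V := E)). intros s _. apply Hcont. }
  assert (H1 : is_RInt (fun s => frozen T s (w (r - s))) 0 tau (minus (conv w r) I2)).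
  { apply (is_RInt_Chasles (V := E)) with r; [apply Hin|].
    now apply (is_RInt_swap (V := E)). }
  assert (N2 : norm I2 <= Rabs (r - tau) * (M * C)).
  { apply (norm_RInt_le_const_abs (V := E) (fun s => frozen T s (w (r - s))) tau r); [|exact H2].
    intros s Hs.
    assert (- K <= s <= K).
    { revert Hs. unfold Rmin, Rmax. destruct (Rle_dec _ _); lra. }
    eapply Rle_trans; [apply HB; lra|]. apply Rmult_le_compat_l; [lra|]. apply HCb. lra. }
  assert (N1 : ndist (minus (conv w r) I2) (conv w tau) <= Rabs (tau - 0) * (M * (eps / (4 * K * M)))).
  { unfold ndist.
    apply (norm_RInt_le_const_abs (V := E)
      (fun s => minus (frozen T s (w (r - s))) (frozen T s (w (tau - s)))) 0 tau).
    2: { apply (is_RInt_minus (V := E)); [exact H1|apply Hin]. }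
    intros s Hs.
    assert (- K <= s <= K).
    { revert Hs. unfold Rmin, Rmax. destruct (Rle_dec _ _); lra. }
    eapply Rle_trans; [apply (frozen_ndist T HT M); intros z; apply HB; lra|].
    apply Rmult_le_compat_l; [lra|]. apply Rlt_le.
    apply (Hd (tau - s) (r - s)); [lra|lra|].
    change (Rabs (r - s - (tau - s)) < d). now replace (r - s - (tau - s)) with (r - tau) by ring. }
  assert (Rabs (tau - 0) * (M * (eps / (4 * K * M))) <= eps / 4).
  { rewrite Rminus_0_r. apply Rle_trans with (K * (M * (eps / (4 * K * M)))).
    - apply Rmult_le_compat_r; [apply Rmult_le_pos; lra|unfold K; lra].
    - right. field. lra. }
  assert (Rabs (r - tau) * (M * C) <= eps / 4).
  { apply Rle_trans with (eps / (4 * M * C) * (M * C)).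
    - apply Rmult_le_compat_r; [apply Rmult_le_pos; lra|lra].
    - right. field. lra. }
  assert (ndist (conv w r) (minus (conv w r) I2) = norm I2).
  { unfold ndist. f_equal. module_in E. }
  generalize (ndist_triangle (conv w r) (minus (conv w r) I2) (conv w tau)). lra.
Qed.

(** The variation of constants formula may be restarted at any time [tau]. *)
Lemma conv_split (w : R -> E) (tau h : R) :
  (forall s, continuous w s) -> 0 <= tau -> 0 <= h ->
  conv w (tau + h) = plus (frozen T h (conv w tau)) (conv (fun s => w (tau + s)) h).
Proof.
  intros Hw Ht Hh. apply conv_unique.
  apply (is_RInt_Chasles (V := E)) with tau.
  - apply is_RInt_ext with (fun s => frozen T h (frozen T (tau - s) (w s))).
    + intros s Hs. rewrite Rmin_left, Rmax_right in Hs by lra.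
      rewrite <- (frozen_plus T HT) by lra. f_equal. ring.
    + apply (is_RInt_linear (V := E) (W := E) (frozen T h));
        [apply (frozen_linear T HT)|now apply conv_correct].
  - assert (H : is_RInt (fun s => frozen T (h - s) (w (tau + s)))
      (1 * tau + - tau) (1 * (tau + h) + - tau) (conv (fun s => w (tau + s)) h)).
    { replace (1 * tau + - tau) with 0 by ring.
      replace (1 * (tau + h) + - tau) with h by ring.
      apply conv_correct. intros s. apply (continuous_comp (fun s => tau + s) w); [|apply Hw].
      apply (continuous_plus (V := R_NormedModule) (fun _ => tau) (fun s => s));
        [apply continuous_const|apply continuous_id]. }
    apply is_RInt_comp_lin in H. revert H. apply is_RInt_ext. intros s _.
    replace (h - (1 * s + - tau)) with (tau + h - s) by ring.
    replace (tau + (1 * s + - tau)) with s by ring. module_in E.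
Qed.

Lemma conv_near_0 (w : R -> E) (eps : R) :
  (forall s, continuous w s) -> 0 < eps ->
  at_right 0 (fun h => ndist (conv w h) (scal h (w 0)) <= eps * h).
Proof.
  intros Hw He. apply at_right_0_iff.
  destruct (frozen_bounded T HT 1) as (M & HM & HB).
  destruct (proj1 (continuous_R_iff (W := E) w 0) (Hw 0) (eps / 2 / M))
    as (d1 & Hd1 & H1); [apply Rdiv_lt_0_compat; lra|].
  destruct (proj1 (continuous_R_iff (W := E) _ 0)
    (frozen_orbit_continuous T HT (w 0) 0) (eps / 2)) as (d2 & Hd2 & H2); [lra|].
  exists (Rmin 1 (Rmin d1 d2)). split; [repeat apply Rmin_glb_lt; lra|].
  intros h [Hh Hr]. apply Rmin_Rgt in Hr. destruct Hr as [Hr1 Hr].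
  apply Rmin_Rgt in Hr. destruct Hr as [Hr2 Hr3].
  apply (is_RInt_const_minus (W := E) (fun s => frozen T (h - s) (w s))); [lra| |now apply conv_correct].
  intros s Hs.
  specialize (H1 s ltac:(rewrite Rabs_pos_eq; lra)).
  specialize (H2 (h - s) ltac:(rewrite Rabs_pos_eq; lra)).
  cbv beta in H2. rewrite (frozen_0 T HT) in H2.
  generalize (ndist_triangle (frozen T (h - s) (w s)) (frozen T (h - s) (w 0)) (w 0)).
  assert (ndist (frozen T (h - s) (w s)) (frozen T (h - s) (w 0)) <= M * (eps / 2 / M)).
  { eapply Rle_trans; [apply (frozen_ndist T HT M); intros z; apply HB; lra|].
    apply Rmult_le_compat_l; lra. }
  assert (M * (eps / 2 / M) = eps / 2) by (field; lra). lra.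
Qed.

Lemma conv_ndist (w1 w2 : R -> E) (g : R -> R) (M tau G : R) :
  (forall s, continuous w1 s) -> (forall s, continuous w2 s) ->
  0 <= M -> 0 <= tau ->
  (forall t x, t <= tau -> norm (frozen T t x) <= M * norm x) ->
  (forall s, 0 <= s <= tau -> ndist (w1 s) (w2 s) <= g s) ->
  is_RInt g 0 tau G ->
  ndist (conv w1 tau) (conv w2 tau) <= M * G.
Proof.
  intros H1 H2 HM Ht HB Hg HG.
  apply (norm_RInt_le (V := E)
    (fun s => minus (frozen T (tau - s) (w1 s)) (frozen T (tau - s) (w2 s)))
    (fun s => M * g s) 0 tau); [easy| | |].
  - intros s Hs. eapply Rle_trans; [apply (frozen_ndist T HT M); intros z; apply HB; lra|].
    apply Rmult_le_compat_l; [easy|]. now apply Hg.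
  - apply (is_RInt_minus (V := E)); now apply conv_correct.
  - now apply (is_RInt_scal (V := R_NormedModule)).
Qed.

(** [d/ds T(s) v = T(s) A v] in integrated form. *)
Lemma conv_generator (v y : E) (tau : R) :
  generator_value (k := real_scalars) T v y -> 0 <= tau ->
  conv (fun _ => y) tau = minus (frozen T tau v) v.
Proof.
  intros Hv Ht.
  assert (Hc : forall s, continuous (fun _ : R => y) s)
    by (intros s; apply (continuous_const (U := R_UniformSpace))).
  destruct (frozen_bounded T HT tau) as (M & HM & HB).
  (* [u] has right derivative [0]: its increment over [[s, s + h]] is the image
     under [T s] of its increment over [[0, h]]. *)
  pose (u := fun s => minus (frozen T s v) (conv (fun _ => y) s)).
  assert (Hu : forall s, continuous u s).
  { intros s. apply (continuous_minus (V := E)).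
    - apply (frozen_orbit_continuous T HT).
    - now apply conv_continuous. }
  assert (Hinc : ndist (u tau) (u 0) <= 0).
  { apply le_epsilon. intros eps He. rewrite Rplus_0_l.
    assert (He' : 0 < eps / (2 * M * (tau + 1))) by (apply Rdiv_lt_0_compat; nra).
    apply Rle_trans with (eps / (tau + 1) * (tau - 0)).
    - apply (increment_le (W := E) u 0 tau); [easy|now intros; apply Hu|].
      intros s Hs. apply at_right_0_iff.
      destruct (proj1 (at_right_0_iff _) (conv_near_0 (fun _ => y) _ Hc He'))
        as (d1 & Hd1 & H1).
      destruct (proj1 (at_right_0_iff _)
        (proj1 (filterlim_ndist (W := E) (at_right 0) _ _ _) Hv _ He'))
        as (d2 & Hd2 & H2).
      exists (Rmin d1 d2). split; [now apply Rmin_glb_lt|].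
      intros h [Hh Hr]. apply Rmin_Rgt in Hr. destruct Hr as [Hr1 Hr2].
      specialize (H1 h ltac:(lra)). specialize (H2 h ltac:(lra)). cbv beta in H1, H2.
      pose (z := minus (frozen T h v) v).
      assert (Hz : ndist z (scal h y) <= eps / (2 * M * (tau + 1)) * h).
      { unfold z. rewrite (frozen_eq T) by lra.
        eapply Rle_trans; [right; exact (ndist_quotient (W := E) h _ y Hh)|].
        rewrite Rmult_comm.
        apply Rmult_le_compat_r; [lra|]. apply Rlt_le, H2. }
      assert (Hus : ndist (u (s + h)) (u s) =
        norm (frozen T s (minus z (conv (fun _ => y) h)))).
      { unfold ndist, u. f_equal. rewrite (Rplus_comm s h), (conv_split (fun _ => y) h s), Rplus_comm by (easy || lra).
        rewrite (frozen_plus T HT) by lra. unfold z.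
        rewrite !(linear_minus _ _ _ (frozen_linear T HT s)). module_in E. }
      rewrite Hus.
      eapply Rle_trans; [apply HB; lra|].
      apply Rle_trans with (M * (2 * (eps / (2 * M * (tau + 1)) * h))).
      + apply Rmult_le_compat_l; [lra|].
        change (ndist z (conv (fun _ => y) h) <= 2 * (eps / (2 * M * (tau + 1)) * h)).
        rewrite ndist_sym in H1.
        generalize (ndist_triangle z (scal h y) (conv (fun _ => y) h)). lra.
      + right. field. lra.
    - apply Rmult_le_reg_r with (tau + 1); [lra|].
      replace (eps / (tau + 1) * (tau - 0) * (tau + 1)) with (eps * tau) by (field; lra).
      nra. }
  assert (Heq : u tau = u 0).
  { apply ndist_eq_0. generalize (ndist_ge_0 (u tau) (u 0)). lra. }
  unfold u in Heq. rewrite (frozen_0 T HT), conv_0 in Heq.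
  rewrite <- (opp_opp (conv (fun _ => y) tau)).
  replace (opp (conv (fun _ => y) tau)) with
    (minus (minus (frozen T tau v) (conv (fun _ => y) tau)) (frozen T tau v)) by module_in E.
  rewrite Heq. module_in E.
Qed.

End Convolution.

(** Integrals of the extended semigroup along paths in the smaller space may be
    computed there. *)
Lemma conv_linear {E E' : CompleteNormedModule R_AbsRing} (T : R -> E -> E)
    (T' : R -> E' -> E') (l : E -> E') (w : R -> E) (tau : R) :
  C0_semigroup (k := real_scalars) T -> is_linear l ->
  (forall t x, 0 <= t -> T' t (l x) = l (T t x)) ->
  (forall s, continuous w s) ->
  conv T' (fun s => l (w s)) tau = l (conv T w tau).
Proof.
  intros HT Hl HTl Hw. apply conv_unique.
  apply is_RInt_ext with (fun s => l (frozen T (tau - s) (w s))).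
  - intros s _. symmetry. apply HTl, Rmax_l.
  - apply (is_RInt_linear (V := E) (W := E')); [easy|]. now apply conv_correct.
Qed.

(** * Semilinear Volterra equations *)

Lemma ndist_bounded {W : NormedModule R_AbsRing} (u v : R -> W) (K : R) :
  0 <= K -> (forall s, continuous u s) -> (forall s, continuous v s) ->
  exists C, 0 <= C /\ forall s, 0 <= s <= K -> ndist (u s) (v s) <= C.
Proof.
  intros HK Hu Hv.
  destruct (continuity_ab_maj (fun s => ndist (u s) (v s)) 0 K) as (m & Hm & _); [easy| |].
  - intros s _. apply continuity_pt_filterlim.
    apply (continuous_comp (fun s => minus (u s) (v s)) norm).
    + now apply (continuous_minus (V := W)).
    + apply (filterlim_norm (V := W)).
  - exists (ndist (u m) (v m)). split; [apply ndist_ge_0|exact Hm].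
Qed.

Lemma exp_ge_1 (x : R) : 0 <= x -> 1 <= exp x.
Proof. intros Hx. generalize (exp_ineq1_le x). lra. Qed.

Lemma half_pow_small (C eps : R) :
  0 <= C -> 0 < eps -> exists n, C * (/ 2) ^ n < eps.
Proof.
  intros HC He.
  destruct (pow_lt_1_zero (/ 2)) with (y := eps / (C + 1)) as [N HN].
  - rewrite Rabs_pos_eq; lra.
  - apply Rdiv_lt_0_compat; lra.
  - exists N. specialize (HN N (le_n N)).
    assert (0 < (/ 2) ^ N) by (apply pow_lt; lra).
    rewrite Rabs_pos_eq in HN by lra.
    apply Rle_lt_trans with ((C + 1) * (/ 2) ^ N); [nra|].
    apply Rlt_le_trans with ((C + 1) * (eps / (C + 1))); [nra|]. right. field. lra.
Qed.

(** Freezing a function outside [[0, K]] extends it to the line without losing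
    continuity or uniform bounds. *)
Definition clamp (K s : R) : R := Rmax 0 (Rmin K s).

Lemma clamp_id (K s : R) : 0 <= s <= K -> clamp K s = s.
Proof. intros H. unfold clamp. rewrite Rmin_right, Rmax_right; lra. Qed.

Lemma clamp_range (K s : R) : 0 <= K -> 0 <= clamp K s <= K.
Proof.
  intros H. unfold clamp, Rmax, Rmin.
  destruct (Rle_dec K s), (Rle_dec 0 _); lra.
Qed.

Lemma clamp_dist (K r s : R) : Rabs (clamp K r - clamp K s) <= Rabs (r - s).
Proof.
  unfold clamp, Rmax, Rmin, Rabs.
  repeat destruct (Rle_dec _ _); repeat destruct (Rcase_abs _); lra.
Qed.

Section Volterra.

Context {E : CompleteNormedModule R_AbsRing} (T : R -> E -> E) (phi : E -> E) (L : R).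
Hypothesis HT : C0_semigroup (k := real_scalars) T.
Hypothesis HL : 0 <= L.
Hypothesis Hphi : forall x y, ndist (phi x) (phi y) <= L * ndist x y.

Lemma lipschitz_continuous (u : R -> E) (s : R) :
  continuous u s -> continuous (fun s => phi (u s)) s.
Proof.
  intros Hu. refine (proj2 (continuous_R_iff (W := E) _ s) _). intros eps He.
  destruct (proj1 (continuous_R_iff (W := E) u s) Hu (eps / (L + 1))) as (d & Hd & H).
  { apply Rdiv_lt_0_compat; lra. }
  exists d. split; [easy|]. intros r Hr. specialize (H r Hr).
  eapply Rle_lt_trans; [apply Hphi|].
  apply Rle_lt_trans with ((L + 1) * ndist (u r) (u s)).
  - generalize (ndist_ge_0 (u r) (u s)). nra.
  - apply Rlt_le_trans with ((L + 1) * (eps / (L + 1))); [nra|]. right. field. lra.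
Qed.

(** With the weight [exp (beta s)], [beta] large, the convolution operator is a
    contraction of ratio [1/2] on an interval of any length. *)
Lemma conv_contraction (K M : R) (u v : R -> E) (C : R) :
  0 < M -> (forall t x, t <= K -> norm (frozen T t x) <= M * norm x) ->
  (forall s, continuous u s) -> (forall s, continuous v s) -> 0 <= C ->
  (forall s, 0 <= s <= K -> ndist (u s) (v s) <= C * exp ((2 * (M * L) + 1) * s)) ->
  forall tau, 0 <= tau <= K ->
  ndist (conv T (fun s => phi (u s)) tau) (conv T (fun s => phi (v s)) tau)
    <= C / 2 * exp ((2 * (M * L) + 1) * tau).
Proof.
  intros HM HB Hu Hv HC H tau Ht.
  assert (HML : 0 <= M * L) by (apply Rmult_le_pos; lra).
  set (beta := 2 * (M * L) + 1) in *.
  assert (Hbeta : 0 < beta) by (unfold beta; lra).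
  apply Rle_trans with (M * (L * C / beta * exp (beta * tau) - L * C / beta * exp (beta * 0))).
  - apply (conv_ndist T HT _ _ (fun s => L * (C * exp (beta * s)))); try lra.
    + intros s. now apply lipschitz_continuous.
    + intros s. now apply lipschitz_continuous.
    + intros t x Htt. apply HB. lra.
    + intros s Hs. eapply Rle_trans; [apply Hphi|]. apply Rmult_le_compat_l; [easy|].
      apply H. lra.
    + apply (is_RInt_derive (V := R_CompleteNormedModule)
        (fun s => L * C / beta * exp (beta * s))).
      * intros s _. auto_derive; [easy|]. field. lra.
      * intros s _. apply (ex_derive_continuous (V := R_NormedModule)). auto_derive. easy.
  - rewrite Rmult_0_r, exp_0.
    assert (He : 0 < exp (beta * tau)) by apply exp_pos.
    assert (HMLb : M * L * / beta <= / 2).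
    { apply Rmult_le_reg_r with beta; [easy|].
      rewrite Rmult_assoc, Rinv_l by lra. unfold beta. lra. }
    replace (M * (L * C / beta * exp (beta * tau) - L * C / beta * 1)) with
      (M * L * / beta * (C * (exp (beta * tau) - 1))) by (field; lra).
    assert (1 <= exp (beta * tau)) by (apply exp_ge_1; nra).
    assert (0 <= C * (exp (beta * tau) - 1)) by (apply Rmult_le_pos; lra).
    apply Rle_trans with (/ 2 * (C * (exp (beta * tau) - 1))); [nra|]. nra.
Qed.

(** Applying the contraction [n] times bounds the difference of two solutions by
    [C 2^(-n) exp (beta s)]. *)
Lemma volterra_unique (u v : R -> E) (K : R) :
  (forall s, continuous u s) -> (forall s, continuous v s) ->
  (forall tau, 0 <= tau <= K -> ndist (u tau) (v tau) <=
     ndist (conv T (fun s => phi (u s)) tau) (conv T (fun s => phi (v s)) tau)) ->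
  forall tau, 0 <= tau <= K -> u tau = v tau.
Proof.
  intros Hu Hv H tau Ht.
  destruct (frozen_bounded T HT K) as (M & HM & HB).
  destruct (ndist_bounded u v K) as (C & HC & HCb); [lra|easy|easy|].
  assert (Hn : forall n s, 0 <= s <= K ->
    ndist (u s) (v s) <= C * (/ 2) ^ n * exp ((2 * (M * L) + 1) * s)).
  { induction n as [|n IH]; intros s Hs.
    - eapply Rle_trans; [now apply HCb|]. rewrite pow_O, Rmult_1_r.
      assert (0 <= M * L) by (apply Rmult_le_pos; lra).
      assert (1 <= exp ((2 * (M * L) + 1) * s)); [|nra].
      apply exp_ge_1, Rmult_le_pos; lra.
    - eapply Rle_trans; [now apply H|].
      replace (C * (/ 2) ^ S n) with (C * (/ 2) ^ n / 2) by (simpl; field).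
      apply (conv_contraction K); try easy.
      apply Rmult_le_pos; [easy|]. apply pow_le. lra. }
  apply ndist_eq_0. apply Rle_antisym; [|apply ndist_ge_0].
  apply le_epsilon. intros eps He. rewrite Rplus_0_l.
  destruct (half_pow_small (C * exp ((2 * (M * L) + 1) * tau)) eps) as [n Hn']; [|easy|].
  - apply Rmult_le_pos; [easy|]. apply Rlt_le, exp_pos.
  - generalize (Hn n tau Ht). lra.
Qed.

(** Picard iteration, the functions being frozen outside [[0, K]]. *)
Lemma volterra_exists (g : R -> E) (K : R) :
  0 <= K -> (forall s, continuous g s) ->
  exists u : R -> E, (forall s, continuous u s) /\
    forall tau, 0 <= tau <= K -> u tau = plus (g tau) (conv T (fun s => phi (u s)) tau).
Proof.
  intros HK Hg.
  destruct (frozen_bounded T HT K) as (M & HM & HB).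
  assert (Hclamp : forall s, continuous (clamp K) s).
  { intros s. refine (proj2 (continuous_R_iff (W := R_NormedModule) _ s) _).
    intros eps He. exists eps. split; [easy|]. intros r Hr.
    eapply Rle_lt_trans; [apply (clamp_dist K r s)|easy]. }
  pose (step := fun (u : R -> E) (s : R) =>
    plus (g (clamp K s)) (conv T (fun r => phi (u r)) (clamp K s))).
  assert (Hstep : forall u, (forall s, continuous u s) -> forall s, continuous (step u) s).
  { intros u Hu s. apply (continuous_plus (V := E)).
    - apply (continuous_comp (clamp K) g); [apply Hclamp|apply Hg].
    - apply (continuous_comp (clamp K) (conv T (fun r => phi (u r)))); [apply Hclamp|].
      apply conv_continuous; [easy|]. intros r. now apply lipschitz_continuous. }
  pose (U := fun n => Nat.iter n step (fun s => g (clamp K s))).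
  assert (HU : forall n s, continuous (U n) s).
  { induction n as [|n IH].
    - intros s. apply (continuous_comp (clamp K) g); [apply Hclamp|apply Hg].
    - now apply Hstep. }
  assert (HUS : forall n s, U (S n) s = step (U n) s) by reflexivity.
  assert (HUc : forall n s, U n s = U n (clamp K s)).
  { intros n s. generalize (clamp_range K s HK). intros Hr.
    destruct n; simpl; unfold step; now rewrite (clamp_id K (clamp K s) Hr). }
  destruct (ndist_bounded (U 1%nat) (U 0%nat) K HK (HU 1%nat) (HU 0%nat)) as (C & HC & HCb).
  set (beta := 2 * (M * L) + 1) in *.
  assert (HML : 0 <= M * L) by (apply Rmult_le_pos; lra).
  assert (Hexp : forall s, 0 <= s -> 1 <= exp (beta * s)).
  { intros s Hs. apply exp_ge_1, Rmult_le_pos; unfold beta; lra. }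
  assert (Hp : forall n, 0 < (/ 2) ^ n) by (intros n; apply pow_lt; lra).
  assert (Hinc : forall n s, 0 <= s <= K ->
    ndist (U (S n) s) (U n s) <= C * (/ 2) ^ n * exp (beta * s)).
  { induction n as [|n IH]; intros s Hs.
    - eapply Rle_trans; [now apply HCb|]. rewrite pow_O, Rmult_1_r.
      specialize (Hexp s (proj1 Hs)). nra.
    - rewrite (HUS (S n)), (HUS n). unfold step. rewrite (clamp_id K s Hs).
      replace (C * (/ 2) ^ S n) with (C * (/ 2) ^ n / 2) by (simpl; field).
      eapply Rle_trans; [|apply (conv_contraction K M (U (S n)) (U n)); try easy].
      + right. unfold ndist. f_equal. module_in E.
      + apply Rmult_le_pos; [easy|]. now apply Rlt_le. }
  pose (C' := C * exp (beta * K)).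
  assert (HC' : 0 <= C') by (apply Rmult_le_pos; [easy|]; apply Rlt_le, exp_pos).
  assert (Hinc' : forall n s, ndist (U (S n) s) (U n s) <= C' * (/ 2) ^ n).
  { intros n s. rewrite (HUc (S n)), (HUc n).
    generalize (clamp_range K s HK). intros Hr.
    eapply Rle_trans; [now apply Hinc|]. unfold C'.
    assert (exp (beta * clamp K s) <= exp (beta * K)).
    { destruct (Req_dec (clamp K s) K) as [->|]; [lra|].
      left. apply exp_increasing. unfold beta. nra. }
    specialize (Hp n). assert (0 <= C * (/ 2) ^ n) by nra. nra. }
  assert (Hlim : forall s, exists l : E, forall n, ndist l (U n s) <= 2 * C' * (/ 2) ^ n).
  { intros s. destruct (controlled_seq_cv (fun n => U n s) (fun n => 2 * C' * (/ 2) ^ n))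
      as (l & _ & Hl); [| |now exists l].
    - intros n m Hnm.
      assert (ndist (U m s) (U n s) <= 2 * C' * (/ 2) ^ n - 2 * C' * (/ 2) ^ m).
      { induction Hnm as [|m Hnm IH]; [rewrite ndist_refl; lra|].
        generalize (ndist_triangle (U (S m) s) (U m s) (U n s)) (Hinc' m s).
        simpl ((/ 2) ^ S m). lra. }
      specialize (Hp m). nra.
    - intros eps He. apply half_pow_small; lra. }
  pose (u := fun s => proj1_sig (constructive_indefinite_description _ (Hlim s))).
  assert (Hu : forall s n, ndist (u s) (U n s) <= 2 * C' * (/ 2) ^ n).
  { intros s. unfold u. now destruct (constructive_indefinite_description _ (Hlim s)). }
  assert (Huc : forall s, continuous u s).
  { intros s. refine (proj2 (continuous_R_iff (W := E) _ s) _). intros eps He.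
    destruct (half_pow_small (2 * C') (eps / 3)) as [n Hn]; [lra|lra|].
    destruct (proj1 (continuous_R_iff (W := E) _ s) (HU n s) (eps / 3)) as (d & Hd & H); [lra|].
    exists d. split; [easy|]. intros r Hr. specialize (H r Hr).
    generalize (ndist_triangle (u r) (U n r) (u s)) (ndist_triangle (U n r) (U n s) (u s))
      (Hu r n) (Hu s n). rewrite (ndist_sym (U n s) (u s)). lra. }
  exists u. split; [easy|]. intros tau Ht.
  apply ndist_eq_0. apply Rle_antisym; [|apply ndist_ge_0].
  apply le_epsilon. intros eps He. rewrite Rplus_0_l.
  destruct (half_pow_small (2 * C' * (1 + exp (beta * tau))) eps) as [n Hn]; [|easy|].
  { apply Rmult_le_pos; [lra|]. generalize (exp_pos (beta * tau)). lra. }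
  eapply Rle_trans; [apply (ndist_triangle _ (U (S n) tau))|].
  assert (H1 : ndist (U (S n) tau) (plus (g tau) (conv T (fun s => phi (u s)) tau))
    <= (2 * C' * (/ 2) ^ n) / 2 * exp (beta * tau)).
  { rewrite (HUS n). unfold step. rewrite (clamp_id K tau Ht).
    eapply Rle_trans; [|apply (conv_contraction K M (U n) u); try easy].
    - right. unfold ndist. f_equal. module_in E.
    - apply Rmult_le_pos; [lra|]. now apply Rlt_le.
    - intros s Hs. rewrite ndist_sym. eapply Rle_trans; [apply Hu|].
      specialize (Hexp s (proj1 Hs)). specialize (Hp n).
      assert (0 <= 2 * C' * (/ 2) ^ n) by nra. fold beta. nra. }
  specialize (Hu tau (S n)). simpl ((/ 2) ^ S n) in Hu.
  specialize (Hp n). assert (0 <= 2 * C' * (/ 2) ^ n) by nra.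
  generalize (exp_pos (beta * tau)). nra.
Qed.

End Volterra.

(** * The semilinear equation with a constant input in the larger space *)

(** [G] is the restriction to [E] of the generator of [T'].  The decomposition
    [b = j w - G v] holds as soon as a resolvent of that generator maps [E'] into
    [j E]. *)
Section MildSolution.

Context {E E' : CompleteNormedModule R_AbsRing}.
Context (T : R -> E -> E) (T' : R -> E' -> E') (j G : E -> E') (phi : E -> E) (L : R).
Hypothesis HT : C0_semigroup (k := real_scalars) T.
Hypothesis HT' : C0_semigroup (k := real_scalars) T'.
Hypothesis Hj : is_linear j.
Hypothesis j_inj : forall x y, j x = j y -> x = y.
Hypothesis j_T : forall t x, 0 <= t -> T' t (j x) = j (T t x).
Hypothesis HG : is_linear G.
Hypothesis G_generator : forall v : E, generator_value (k := real_scalars) T' (j v) (G v).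
Hypothesis jG_onto : forall b : E', exists w v, b = minus (j w) (G v).
Hypothesis HL : 0 <= L.
Hypothesis Hphi : forall x y, ndist (phi x) (phi y) <= L * ndist x y.

Let linear_continuous (l : E -> E') (u : R -> E) (s : R) :
  is_linear l -> continuous u s -> continuous (fun s => l (u s)) s.
Proof. intros Hl Hu. apply (continuous_comp u l); [easy|]. apply (linear_cont l _ Hl). Qed.

Let const_continuous (F : UniformSpace) (b : F) (s : R) : continuous (fun _ : R => b) s.
Proof. apply (continuous_const (U := R_UniformSpace)). Qed.

Definition forcing (b : E') (u : R -> E) (s : R) : E' := plus b (j (phi (u s))).

Lemma forcing_continuous (b : E') (u : R -> E) :
  (forall s, continuous u s) -> forall s, continuous (forcing b u) s.
Proof.
  intros Hu s. apply (continuous_plus (V := E')); [apply const_continuous|].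
  apply (linear_continuous j (fun s => phi (u s))); [easy|].
  now apply (lipschitz_continuous phi L).
Qed.

(** The effect of a constant input of [E'] is a continuous path in [E]: for
    [b = j w - A' (j v)] the integral of [T'(s) b] is
    [j (int_0^tau T(s) w ds - (T(tau) v - v))]. *)
Lemma constant_input (b : E') :
  exists Phi : R -> E, (forall s, continuous Phi s) /\
    forall tau, 0 <= tau -> conv T' (fun _ => b) tau = j (Phi tau).
Proof.
  destruct (jG_onto b) as (w & v & ->).
  exists (fun tau => minus (conv T (fun _ => w) tau) (minus (frozen T tau v) v)). split.
  - intros s. apply (continuous_minus (V := E)).
    + apply conv_continuous; [easy|]. intros r. apply const_continuous.
    + apply (continuous_minus (V := E)); [|apply const_continuous].
      now apply frozen_orbit_continuous.
  - intros tau Ht. rewrite !(linear_minus j _ _ Hj).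
    rewrite <- (conv_linear T T' j) by (easy || apply const_continuous).
    unfold frozen at 1. rewrite <- j_T by apply Rmax_l.
    change (T' (Rmax 0 tau) (j v)) with (frozen T' tau (j v)).
    etransitivity; [|apply f_equal; exact (conv_generator T' HT' (j v) (G v) tau (G_generator v) Ht)].
    rewrite <- (minus_plus_cancel (conv T' (fun _ => minus (j w) (G v)) tau)
      (conv T' (fun _ => G v) tau)) at 1.
    assert (Hs : conv T' (fun _ => j w) tau =
      plus (conv T' (fun _ => minus (j w) (G v)) tau) (conv T' (fun _ => G v) tau)).
    { rewrite <- conv_plus by (easy || intros r; apply const_continuous).
      apply conv_ext; [easy|]. intros s _. module_in E'. }
    rewrite Hs. module_in E'.
Qed.

(** The variation of constants formula on [[0, K]] for [u' = A' u + b + phi(u)]. *)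
Definition mild_solution (a : E) (b : E') (K : R) (u : R -> E) : Prop :=
  forall tau, 0 <= tau <= K ->
    j (u tau) = plus (frozen T' tau (j a)) (conv T' (forcing b u) tau).

(** Only the constant part of the forcing leaves the smaller space. *)
Lemma conv_forcing (b : E') (u : R -> E) (tau : R) :
  (forall s, continuous u s) ->
  conv T' (forcing b u) tau =
    plus (conv T' (fun _ => b) tau) (j (conv T (fun s => phi (u s)) tau)).
Proof.
  intros Hu. rewrite <- (conv_linear T T' j) by (easy || intros s; now apply (lipschitz_continuous phi L)).
  apply (conv_plus T' HT' (fun _ => b)); [apply const_continuous|].
  intros s. apply (linear_continuous j (fun s => phi (u s))); [easy|].
  now apply (lipschitz_continuous phi L).
Qed.

Lemma mild_solution_exists (a : E) (b : E') (K : R) :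
  0 <= K -> exists u : R -> E, (forall s, continuous u s) /\ mild_solution a b K u.
Proof.
  intros HK. destruct (constant_input b) as (Phi & HPhi & Hb).
  destruct (volterra_exists T phi L HT HL Hphi (fun s => plus (frozen T s a) (Phi s)) K HK)
    as (u & Hu & Heq).
  { intros s. apply (continuous_plus (V := E)); [now apply frozen_orbit_continuous|apply HPhi]. }
  exists u. split; [easy|]. intros tau Ht.
  rewrite (Heq tau Ht), !(linear_plus j Hj), conv_forcing, Hb by (easy || lra).
  unfold frozen. rewrite j_T by apply Rmax_l. module_in E'.
Qed.

Lemma mild_solution_0 (a : E) (b : E') (K : R) (u : R -> E) :
  0 <= K -> mild_solution a b K u -> u 0 = a.
Proof.
  intros HK Hu. apply j_inj. rewrite (Hu 0) by lra.
  rewrite (frozen_0 T' HT'), conv_0. module_in E'.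
Qed.

Lemma mild_solution_unique (a : E) (b : E') (K : R) (u v : R -> E) :
  (forall s, continuous u s) -> (forall s, continuous v s) ->
  mild_solution a b K u -> mild_solution a b K v ->
  forall tau, 0 <= tau <= K -> u tau = v tau.
Proof.
  intros Hu Hv Hmu Hmv. apply (volterra_unique T phi L HT HL Hphi); [easy|easy|].
  intros tau Ht. right. unfold ndist. f_equal. apply j_inj.
  rewrite !(linear_minus j _ _ Hj), (Hmu tau Ht), (Hmv tau Ht), !conv_forcing by easy.
  module_in E'.
Qed.

Definition velocity (b : E') (u : R -> E) (s : R) : E' :=
  plus (G (u s)) (forcing b u s).

Lemma velocity_continuous (b : E') (u : R -> E) :
  (forall s, continuous u s) -> forall s, continuous (velocity b u) s.
Proof.
  intros Hu s. apply (continuous_plus (V := E')).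
  - now apply linear_continuous.
  - now apply forcing_continuous.
Qed.

(** Restarting the variation of constants formula at [tau], the two terms of
    [u(tau + h)] contribute [A' (j (u tau))] and [forcing b u tau]. *)
Lemma mild_solution_right_derivative (a : E) (b : E') (K : R) (u : R -> E) (tau eps : R) :
  (forall s, continuous u s) -> mild_solution a b K u -> 0 <= tau < K -> 0 < eps ->
  at_right 0 (fun h =>
    ndist (minus (j (u (tau + h))) (j (u tau))) (scal h (velocity b u tau)) <= eps * h).
Proof.
  intros Hu Hm Ht He. apply at_right_0_iff.
  assert (Hw : forall s, continuous (fun s : R => forcing b u (tau + s)) s).
  { intros s. apply (continuous_comp (fun s => tau + s) (forcing b u)).
    - apply (continuous_plus (V := R_NormedModule) (fun _ => tau) (fun s => s));
        [apply const_continuous|apply continuous_id].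
    - now apply forcing_continuous. }
  assert (He2 : 0 < eps / 2) by lra.
  destruct (proj1 (at_right_0_iff _) (conv_near_0 T' HT' _ _ Hw He2)) as (d1 & Hd1 & H1).
  destruct (proj1 (at_right_0_iff _)
    (proj1 (filterlim_ndist (W := E') (at_right 0) _ _ _) (G_generator (u tau)) _ He2))
    as (d2 & Hd2 & H2).
  exists (Rmin (K - tau) (Rmin d1 d2)). split; [repeat apply Rmin_glb_lt; lra|].
  intros h [Hh Hr]. apply Rmin_Rgt in Hr. destruct Hr as [Hr0 Hr].
  apply Rmin_Rgt in Hr. destruct Hr as [Hr1 Hr2].
  specialize (H1 h ltac:(lra)). specialize (H2 h ltac:(lra)). cbv beta in H1, H2.
  rewrite Rplus_0_r in H1.
  assert (Hrestart : j (u (tau + h)) =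
    plus (T' h (j (u tau))) (conv T' (fun s => forcing b u (tau + s)) h)).
  { rewrite (Hm (tau + h)), (Hm tau) by lra.
    rewrite (conv_split T' HT' _ tau h) by (lra || now apply forcing_continuous).
    rewrite <- (frozen_eq T') by lra. rewrite (Rplus_comm tau h), (frozen_plus T' HT') by lra.
    rewrite (linear_plus _ (frozen_linear T' HT' h)). module_in E'. }
  assert (H2' : ndist (minus (T' h (j (u tau))) (j (u tau))) (scal h (G (u tau))) <= eps / 2 * h).
  { eapply Rle_trans; [right; exact (ndist_quotient (W := E') h _ _ Hh)|].
    rewrite Rmult_comm. apply Rmult_le_compat_r; [lra|]. apply Rlt_le, H2. }
  rewrite Hrestart.
  replace (eps * h) with (eps / 2 * h + eps / 2 * h) by field.
  eapply Rle_trans; [|apply Rplus_le_compat; [exact H2'|exact H1]].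
  unfold ndist.
  eapply Rle_trans; [|apply norm_triangle].
  right. f_equal. unfold velocity. module_in E'.
Qed.

(** The right derivative is continuous, so the mean value inequality makes it a
    derivative, one-sided at the end points. *)
Lemma mild_solution_derivative (a : E) (b : E') (K : R) (u : R -> E) (s eps : R) :
  (forall s, continuous u s) -> mild_solution a b K u -> 0 <= s <= K -> 0 < eps ->
  exists d, 0 < d /\ forall r, 0 <= r <= K -> Rabs (r - s) < d ->
    ndist (minus (j (u r)) (j (u s))) (scal (r - s) (velocity b u s)) <= eps * Rabs (r - s).
Proof.
  intros Hu Hm Hs He. assert (He2 : 0 < eps / 2) by lra.
  destruct (proj1 (continuous_R_iff (W := E') _ s) (velocity_continuous b u Hu s) _ He2)
    as (d & Hd & H).
  exists d. split; [easy|].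
  pose (z := fun r => minus (j (u r)) (scal r (velocity b u s))).
  assert (key : forall p q, 0 <= p -> p <= q -> q <= K -> Rabs (p - s) < d -> Rabs (q - s) < d ->
    ndist (z q) (z p) <= eps * (q - p)).
  { intros p q Hp Hpq Hq Hps Hqs.
    apply Rabs_lt_between' in Hps. apply Rabs_lt_between' in Hqs.
    apply (increment_le (W := E') z); [easy| |].
    - intros r _. apply (continuous_minus (V := E')).
      + now apply linear_continuous.
      + apply (continuous_scal_l (V := E') (fun r : R => r)). apply continuous_id.
    - intros r Hr. apply at_right_0_iff.
      destruct (proj1 (at_right_0_iff _)
        (mild_solution_right_derivative a b K u r (eps / 2) Hu Hm ltac:(lra) He2))
        as (d1 & Hd1 & H1).
      exists d1. split; [easy|]. intros h Hh. specialize (H1 h Hh).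
      assert (H2 : ndist (velocity b u r) (velocity b u s) < eps / 2).
      { apply H. apply Rabs_lt_between'. lra. }
      assert (H3 : norm (scal h (minus (velocity b u r) (velocity b u s))) <= h * (eps / 2)).
      { eapply Rle_trans; [right; exact (norm_scal_real (W := E') h _)|].
        rewrite Rabs_pos_eq by lra. apply Rmult_le_compat_l; [lra|]. apply Rlt_le, H2. }
      replace (eps * h) with (eps / 2 * h + h * (eps / 2)) by field.
      eapply Rle_trans; [|apply Rplus_le_compat; [exact H1|exact H3]].
      eapply Rle_trans; [|apply norm_triangle].
      right. unfold ndist, z. f_equal. module_in E'. }
  intros r Hr Hrs. assert (Hss : Rabs (s - s) < d) by (rewrite Rminus_diag, Rabs_R0; easy).
  assert (Hz : ndist (minus (j (u r)) (j (u s))) (scal (r - s) (velocity b u s)) = ndist (z r) (z s)).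
  { unfold ndist, z. f_equal. module_in E'. }
  rewrite Hz. destruct (Rle_lt_dec s r).
  - rewrite Rabs_pos_eq by lra. apply key; lra.
  - rewrite ndist_sym, Rabs_left by lra. replace (- (r - s)) with (s - r) by ring.
    apply key; lra.
Qed.

End MildSolution.

(** * The generator on the extrapolation space *)

Lemma is_linear_realify {k : scalars} {V W : CompleteNormedModule k} (l : V -> W) :
  is_linear l -> is_linear (U := realify V) (V := realify W) l.
Proof.
  intros Hl. split.
  - exact (linear_plus l Hl).
  - intros a x. exact (linear_scal l Hl (ofR a : k) x).
  - exact (linear_norm l Hl).
Qed.

Lemma C0_semigroup_realify {k : scalars} {V : CompleteNormedModule k} (T : R -> V -> V) :
  C0_semigroup T -> C0_semigroup (k := real_scalars) (V := realify V) T.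
Proof.
  intros HT. split.
  - intros t Ht. exact (is_linear_realify (T t) (semigroup_bounded T HT t Ht)).
  - exact (semigroup_0 T HT).
  - exact (semigroup_plus T HT).
  - exact (semigroup_cont T HT).
Qed.

Lemma at_right_0_pos (P : R -> Prop) : (forall h, 0 < h -> P h) -> at_right 0 P.
Proof. intros H. apply at_right_0_iff. exists 1. split; [lra|]. intros h Hh. apply H; lra. Qed.

Lemma filterlim_norm_eq {K : AbsRing} {V W : NormedModule K} {I : Type}
    (Q : (I -> Prop) -> Prop) (FQ : ProperFilter Q) (f : I -> V) (g : I -> W) (x : V) (y : W) :
  filterlim f Q (locally x) -> filterlim g Q (locally y) ->
  Q (fun i => norm (f i) = norm (g i)) -> norm x = norm y.
Proof.
  intros Hf Hg H.
  apply (filterlim_locally_unique (F := Q) (V := R_NormedModule) (fun i => norm (f i))).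
  - exact (filterlim_comp _ _ _ f norm Q (locally x) _ Hf (filterlim_norm x)).
  - apply (filterlim_ext_loc (F := Q) (fun i => norm (g i))).
    + revert H. apply filter_imp. intros i Hi. now symmetry.
    + exact (filterlim_comp _ _ _ g norm Q (locally y) _ Hg (filterlim_norm y)).
Qed.

Section Extrapolation.

Context {k : scalars} {X X' : CompleteNormedModule k}.
Context (T : R -> X -> X) (D : X -> Prop) (A : X -> X) (j : X -> X') (T' : R -> X' -> X').
Context (lambda : k) (Rl : X -> X).
Hypothesis HT : C0_semigroup T.
Hypothesis HA : is_generator T D A.
Hypothesis HR : is_resolvent D A lambda Rl.
Hypothesis Hj : is_completion (fun x => norm (Rl x)) X' j.
Hypothesis j_T : forall t x, 0 <= t -> T' t (j x) = j (T t x).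

Let Rl_linear : is_linear Rl := proj1 HR.

Lemma embedding_linear : is_linear j.
Proof.
  split.
  - exact (completion_plus _ _ _ Hj).
  - exact (completion_scal _ _ _ Hj).
  - destruct (linear_norm _ Rl_linear) as (M & HM & H). exists M. split; [easy|].
    intros x. rewrite (completion_norm _ _ _ Hj). apply H.
Qed.

Lemma embedding_ndist (x y : X) : ndist (j x) (j y) = ndist (Rl x) (Rl y).
Proof.
  transitivity (norm (j (minus x y))).
  - unfold ndist. f_equal. symmetry. apply (linear_minus j x y embedding_linear).
  - rewrite (completion_norm _ _ _ Hj). unfold ndist. f_equal.
    apply (linear_minus Rl x y Rl_linear).
Qed.

Lemma generator_resolvent (x : X) : A (Rl x) = minus (scal lambda (Rl x)) x.
Proof.
  destruct (proj1 (proj2 HR) x) as [_ H].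
  transitivity (minus (scal lambda (Rl x)) (minus (scal lambda (Rl x)) (A (Rl x)))).
  - module_in (realify X).
  - exact (f_equal (fun z => minus (scal lambda (Rl x)) z) H).
Qed.

Lemma resolvent_injective (x y : X) : Rl x = Rl y -> x = y.
Proof.
  intros H.
  rewrite <- (proj2 (proj1 (proj2 HR) x)), <- (proj2 (proj1 (proj2 HR) y)).
  now rewrite H.
Qed.

Lemma embedding_injective (x y : X) : j x = j y -> x = y.
Proof.
  intros H. apply resolvent_injective, ndist_eq_0.
  rewrite <- embedding_ndist, H. apply ndist_refl.
Qed.

Definition quotient (v : X) (h : R) : X := scal (@ofR k (/ h)) (minus (T h v) v).

Lemma generator_limit (x : X) :
  filterlim (quotient (Rl x)) (at_right 0) (locally (A (Rl x))).
Proof. apply (proj2 HA), (proj1 (proj2 HR) x). Qed.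

Lemma linear_quotient (l : X -> X) (v : X) (h : R) :
  is_linear l -> l (T h v) = T h (l v) -> l (quotient v h) = quotient (l v) h.
Proof.
  intros Hl H. unfold quotient. rewrite (linear_scal l Hl). f_equal.
  etransitivity; [apply (linear_minus l _ _ Hl)|]. now rewrite H.
Qed.

(** [T(t) R x] lies in the domain and [A T(t) R x = T(t) A R x], so that
    [(lambda - A) T(t) R x = T(t) x]; apply [R]. *)
Lemma resolvent_commutes (t : R) (x : X) : 0 <= t -> Rl (T t x) = T t (Rl x).
Proof.
  intros Ht.
  assert (Hlin : is_linear (T t)) by now apply (semigroup_bounded T HT).
  assert (Hgen : filterlim (quotient (T t (Rl x))) (at_right 0) (locally (T t (A (Rl x))))).
  { apply (filterlim_ext_loc (fun h => T t (quotient (Rl x) h))).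
    - apply at_right_0_pos. intros h Hh. apply linear_quotient; [easy|].
      rewrite <- !(semigroup_plus T HT) by lra. f_equal. ring.
    - apply (linear_filterlim (at_right 0) _ (T t) _ _ Hlin), generator_limit. }
  assert (HD : D (T t (Rl x))) by (apply (proj1 HA); now exists (T t (A (Rl x)))).
  assert (HAT : A (T t (Rl x)) = T t (A (Rl x))).
  { apply (filterlim_locally_unique (F := at_right 0) (quotient (T t (Rl x)))); [|easy].
    now apply (proj2 HA). }
  rewrite <- (proj2 (proj2 HR) _ HD), HAT. f_equal.
  rewrite <- (linear_scal _ Hlin).
  etransitivity; [|apply (linear_minus (T t) _ _ Hlin)].
  f_equal. symmetry. apply (proj2 (proj1 (proj2 HR) x)).
Qed.

Lemma resolvent_quotient (v : X) :
  filterlim (fun h => Rl (quotient v h)) (at_right 0) (locally (A (Rl v))).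
Proof.
  apply (filterlim_ext_loc (quotient (Rl v))).
  - apply at_right_0_pos. intros h Hh. symmetry.
    apply linear_quotient; [easy|]. apply resolvent_commutes. lra.
  - apply generator_limit.
Qed.

(** [X] lies in the domain of the extended generator: the difference quotients
    at [v] are Cauchy in [X'], as their resolvents converge to [A (Rl v)]. *)
Lemma extrapolated_generator_exists (v : X) :
  exists y : X', filterlim (fun h => j (quotient v h)) (at_right 0) (locally y).
Proof.
  apply (proj1 (filterlim_locally_cauchy (fun h => j (quotient v h)))). intros eps.
  assert (He : 0 < eps / 2) by (generalize (cond_pos eps); lra).
  exists (fun h => ndist (Rl (quotient v h)) (A (Rl v)) < eps / 2). split.
  - exact (proj1 (filterlim_ndist (at_right 0) _ _ _) (resolvent_quotient v) _ He).
  - intros r h Hr Hh. apply (norm_compat1 (V := X')).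
    change (ndist (j (quotient v h)) (j (quotient v r)) < eps). rewrite embedding_ndist.
    rewrite ndist_sym in Hr.
    generalize (ndist_triangle (Rl (quotient v h)) (A (Rl v)) (Rl (quotient v r))). lra.
Qed.

Lemma quotient_limit_generator (v : X) (y : X') :
  filterlim (fun h => j (quotient v h)) (at_right 0) (locally y) ->
  generator_value T' (j v) y.
Proof.
  apply filterlim_ext_loc. apply at_right_0_pos. intros h Hh.
  unfold quotient. rewrite (linear_scal j embedding_linear). f_equal.
  etransitivity; [apply (linear_minus j _ _ embedding_linear)|].
  rewrite j_T by lra. reflexivity.
Qed.

(** The resolvent extends to an isometry from [X'] to [X], and this extension
    sends [j w - A' (j v)] to [Rl w - A (Rl v)]; here only the norms of the two
    vectors are compared, as limits of norms of difference quotients. *)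
Lemma extrapolated_generator_norm (v w : X) (y : X') :
  filterlim (fun h => j (quotient v h)) (at_right 0) (locally y) ->
  ndist (j w) y = ndist (Rl w) (A (Rl v)).
Proof.
  intros Hy. unfold ndist.
  apply (filterlim_norm_eq (at_right 0) _
    (fun h => minus (j w) (j (quotient v h))) (fun h => minus (Rl w) (Rl (quotient v h)))).
  - apply (filterlim_comp_2 (fun _ => j w) (fun h => opp (j (quotient v h))) plus
      (G := locally (j w)) (H := locally (opp y))).
    + apply filterlim_const.
    + exact (filterlim_comp _ _ _ _ opp _ _ _ Hy (filterlim_opp y)).
    + apply (filterlim_plus (j w) (opp y)).
  - apply (filterlim_comp_2 (fun _ => Rl w) (fun h => opp (Rl (quotient v h))) plus
      (G := locally (Rl w)) (H := locally (opp (A (Rl v))))).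
    + apply filterlim_const.
    + exact (filterlim_comp _ _ _ _ opp _ _ _ (resolvent_quotient v) (filterlim_opp _)).
    + apply (filterlim_plus (Rl w) (opp (A (Rl v)))).
  - apply at_right_0_pos. intros h _. apply embedding_ndist.
Qed.

Lemma quotient_limit_plus (v w : X) (y z : X') :
  filterlim (fun h => j (quotient v h)) (at_right 0) (locally y) ->
  filterlim (fun h => j (quotient w h)) (at_right 0) (locally z) ->
  filterlim (fun h => j (quotient (plus v w) h)) (at_right 0) (locally (plus y z)).
Proof.
  intros Hy Hz.
  apply (filterlim_ext_loc (fun h => plus (j (quotient v h)) (j (quotient w h)))).
  - apply at_right_0_pos. intros h Hh.
    rewrite <- (linear_plus j embedding_linear). f_equal. unfold quotient.
    rewrite (linear_plus (T h)) by (apply (semigroup_bounded T HT); lra).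
    generalize (T h v) (T h w). intros a b.
    change (plus (scal (V := realify X) (/ h) (minus a v)) (scal (V := realify X) (/ h) (minus b w))
      = scal (V := realify X) (/ h) (minus (plus a b) (plus v w))).
    module_in (realify X).
  - apply (filterlim_comp_2 (fun h => j (quotient v h)) (fun h => j (quotient w h)) plus
      (G := locally y) (H := locally z)); [easy|easy|].
    apply (filterlim_plus y z).
Qed.

Lemma quotient_limit_scal (a : R) (v : X) (y : X') :
  filterlim (fun h => j (quotient v h)) (at_right 0) (locally y) ->
  filterlim (fun h => j (quotient (scal (@ofR k a) v) h)) (at_right 0)
    (locally (scal (@ofR k a) y)).
Proof.
  intros Hy. apply (filterlim_ext_loc (fun h => scal (@ofR k a) (j (quotient v h)))).
  - apply at_right_0_pos. intros h Hh.
    rewrite <- (linear_scal j embedding_linear). f_equal. unfold quotient.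
    rewrite (linear_scal (T h)) by (apply (semigroup_bounded T HT); lra).
    generalize (T h v). intros b.
    change (scal (V := realify X) a (scal (V := realify X) (/ h) (minus b v))
      = scal (V := realify X) (/ h) (minus (scal (V := realify X) a b) (scal (V := realify X) a v))).
    module_in (realify X).
  - exact (filterlim_comp _ _ _ _ _ _ _ _ Hy (filterlim_scal_r (ofR a : k) y)).
Qed.

(** The decomposition of [b] comes from [J v := j (lambda v) - A' (j v)], which is
    isometric and maps [Rl y] to [j y]: as [X] is complete, its range is closed, and
    it contains the dense subspace [j X]. *)
Theorem extrapolated_generator :
  exists G : X -> X',
    is_linear (U := realify X) (V := realify X') G /\
    (forall v, generator_value T' (j v) (G v)) /\
    forall b : X', exists w v : X, b = minus (j w) (G v).
Proof.
  pose (G := fun v => proj1_sig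
    (constructive_indefinite_description _ (extrapolated_generator_exists v))).
  assert (HG : forall v, filterlim (fun h => j (quotient v h)) (at_right 0) (locally (G v))).
  { intros v. unfold G. now destruct (constructive_indefinite_description _ _). }
  assert (Gunique : forall v y,
    filterlim (fun h => j (quotient v h)) (at_right 0) (locally y) -> G v = y).
  { intros v y Hy.
    exact (filterlim_locally_unique (F := at_right 0) _ _ _ (HG v) Hy). }
  assert (Gplus : forall v w, G (plus v w) = plus (G v) (G w)).
  { intros v w. now apply Gunique, quotient_limit_plus. }
  assert (Hlin : is_linear (U := realify X) (V := realify X') G).
  { split.
    - exact Gplus.
    - intros a v. exact (Gunique _ _ (quotient_limit_scal a v _ (HG v))).
    - destruct (linear_norm _ Rl_linear) as (M & HM & HB).
      exists (abs lambda * M + 1). split.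
      { generalize (abs_ge_0 lambda). nra. }
      enough (Hb : forall v : X, norm (G v) <= (abs lambda * M + 1) * norm v) by exact Hb.
      intros v.
      assert (H : norm (G v) = norm (A (Rl v))).
      { etransitivity; [symmetry; exact (ndist_linear_zero j (G v) embedding_linear)|].
        etransitivity; [exact (extrapolated_generator_norm v zero (G v) (HG v))|].
        exact (ndist_linear_zero Rl (A (Rl v)) Rl_linear). }
      rewrite H, generator_resolvent.
      eapply Rle_trans; [exact (ndist_le_norm (scal lambda (Rl v)) v)|].
      eapply Rle_trans; [apply Rplus_le_compat_r; exact (norm_scal lambda (Rl v))|].
      eapply Rle_trans; [apply Rplus_le_compat_r, Rmult_le_compat_l;
        [apply abs_ge_0|exact (HB v)]|].
      right. ring. }
  exists G. split; [easy|]. split.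
  { intros v. now apply quotient_limit_generator. }
  intros b.
  pose (J := fun v => minus (j (scal lambda v)) (G v)).
  assert (J_minus : forall u v, minus (J u) (J v) = J (minus u v)).
  { intros u v. unfold J.
    assert (E1 : j (scal lambda (minus u v)) = minus (j (scal lambda u)) (j (scal lambda v))).
    { etransitivity; [|apply (linear_minus j _ _ embedding_linear)]. f_equal.
      apply (scal_minus_distr_l lambda u v). }
    assert (E2 : G (minus u v) = minus (G u) (G v)) by exact (linear_minus _ _ _ Hlin).
    rewrite E1, E2. module_in (realify X'). }
  assert (J_norm : forall v, norm (J v) = norm v).
  { intros v. change (ndist (j (scal lambda v)) (G v) = norm v).
    rewrite (extrapolated_generator_norm v _ _ (HG v)).
    assert (E : Rl (scal lambda v) = scal lambda (Rl v)) by apply (linear_scal Rl Rl_linear).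
    unfold ndist. f_equal. rewrite E, generator_resolvent. module_in (realify X). }
  assert (J_Rl : forall y, J (Rl y) = j y).
  { intros y.
    assert (E : j (minus (scal lambda (Rl y)) y) = G (Rl y)).
    { apply ndist_eq_0. rewrite (extrapolated_generator_norm (Rl y) _ _ (HG (Rl y))).
      rewrite generator_resolvent.
      etransitivity; [|apply (ndist_refl (Rl (minus (scal lambda (Rl y)) y)))]. f_equal.
      etransitivity; [|symmetry; apply (linear_minus Rl _ _ Rl_linear)].
      f_equal. symmetry. apply (linear_scal Rl Rl_linear). }
    assert (E' : j (minus (scal lambda (Rl y)) y) = minus (j (scal lambda (Rl y))) (j y))
      by apply (linear_minus j _ _ embedding_linear).
    unfold J. rewrite <- E, E'. module_in (realify X'). }
  assert (Hy : forall n : nat, exists y, ndist b (j y) < / INR (S n)).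
  { intros n. assert (Hn : 0 < / INR (S n)) by (apply Rinv_0_lt_compat, lt_0_INR; lia).
    exact (completion_dense _ _ _ Hj b (mkposreal _ Hn)). }
  pose (y := fun n => proj1_sig (constructive_indefinite_description _ (Hy n))).
  assert (Hyb : forall n, ndist b (j (y n)) < / INR (S n)).
  { intros n. unfold y. now destruct (constructive_indefinite_description _ (Hy n)). }
  assert (Hsmall : forall eps, 0 < eps -> exists N, forall n, (N <= n)%nat -> ndist b (j (y n)) < eps).
  { intros eps He. destruct (INR_archimed 1 (/ eps)) as [N HN]; [lra|].
    rewrite Rmult_1_r in HN. exists N. intros n Hn. eapply Rlt_trans; [apply Hyb|].
    rewrite <- (Rinv_inv eps). apply Rinv_lt_contravar.
    - apply Rmult_lt_0_compat; [now apply Rinv_0_lt_compat|]. apply lt_0_INR; lia.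
    - apply Rlt_le_trans with (INR N); [easy|]. apply le_INR; lia. }
  destruct (cauchy_seq_cv (fun n => Rl (y n))) as [v Hv].
  { intros eps He. destruct (Hsmall (eps / 2)) as [N HN]; [lra|].
    exists N. intros n m Hn Hm. rewrite <- embedding_ndist.
    generalize (ndist_triangle (j (y n)) b (j (y m))) (HN n Hn) (HN m Hm).
    rewrite (ndist_sym (j (y n)) b). lra. }
  exists (scal lambda v), v. change (b = J v).
  apply ndist_eq_0. apply Rle_antisym; [|apply ndist_ge_0].
  apply le_epsilon. intros eps He. rewrite Rplus_0_l.
  destruct (Hsmall (eps / 2)) as [N HN]; [lra|].
  destruct (proj1 (filterlim_seq_iff _ _) Hv (eps / 2)) as [N' HN']; [lra|].
  specialize (HN (max N N') ltac:(lia)). specialize (HN' (max N N') ltac:(lia)).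
  generalize (ndist_triangle b (j (y (max N N'))) (J v)).
  assert (ndist (j (y (max N N'))) (J v) = ndist (Rl (y (max N N'))) v); [|lra].
  rewrite <- J_Rl. unfold ndist. rewrite <- J_norm. f_equal. apply J_minus.
Qed.

End Extrapolation.

(** * Gluing along the sampling times *)

Lemma continuous_on_R_iff {W : NormedModule R_AbsRing} (P : R -> Prop) (f : R -> W) :
  continuous_on P f <->
  forall s, P s -> forall eps, 0 < eps -> exists d, 0 < d /\
    forall r, Rabs (r - s) < d -> P r -> ndist (f r) (f s) < eps.
Proof.
  split; intros H s Hs.
  - intros eps He. apply locally_R_iff.
    exact (proj1 (filterlim_ndist (within P (locally s)) _ f (f s)) (H s Hs) eps He).
  - refine (proj2 (filterlim_ndist (within P (locally s)) _ f (f s)) _).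
    intros eps He. unfold within. apply locally_R_iff. now apply H.
Qed.

Lemma continuous_clamped {W : NormedModule R_AbsRing} (y : R -> W) (a K : R) :
  0 <= a -> 0 <= K -> continuous_on (fun s => 0 <= s) y ->
  forall s, continuous (fun s => y (a + clamp K s)) s.
Proof.
  intros Ha HK Hy s. refine (proj2 (continuous_R_iff (W := W) _ s) _). intros eps He.
  generalize (clamp_range K s HK). intros Hs.
  destruct (proj1 (continuous_on_R_iff _ y) Hy (a + clamp K s) ltac:(lra) eps He)
    as (d & Hd & H).
  exists d. split; [easy|]. intros r Hr. generalize (clamp_range K r HK). intros Hr'.
  apply H; [|lra]. replace (a + clamp K r - (a + clamp K s)) with (clamp K r - clamp K s) by ring.
  eapply Rle_lt_trans; [apply clamp_dist|easy].
Qed.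

Section Sampling.

Context (t : nat -> R).
Hypothesis t_0 : t 0%nat = 0.
Hypothesis t_incr : forall n, t n < t (S n).

Lemma sampling_le (n m : nat) : (n <= m)%nat -> t n <= t m.
Proof.
  induction 1 as [|m _ IH]; [lra|]. specialize (t_incr m). lra.
Qed.

Lemma sampling_ge_0 (n : nat) : 0 <= t n.
Proof. rewrite <- t_0. apply sampling_le. lia. Qed.

Lemma sampling_interval_unique (n m : nat) (s : R) :
  t n <= s < t (S n) -> t m <= s < t (S m) -> n = m.
Proof.
  intros Hn Hm. destruct (Nat.lt_trichotomy n m) as [H|[H|H]]; [|easy|].
  - generalize (sampling_le (S n) m H). lra.
  - generalize (sampling_le (S m) n H). lra.
Qed.

Lemma sampling_interval (s : R) (N : nat) :
  0 <= s < t N -> exists n, t n <= s < t (S n).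
Proof.
  induction N as [|N IH]; intros Hs; [lra|].
  destruct (Rle_lt_dec (t N) s); [now exists N|]. apply IH. lra.
Qed.

Lemma sampling_unbounded (tau_min : R) :
  0 < tau_min -> (forall n, tau_min <= t (S n) - t n) ->
  forall s, exists N, s < t N.
Proof.
  intros Hmin Hgap s.
  assert (H : forall n, INR n * tau_min <= t n).
  { induction n as [|n IH]; [simpl; lra|]. rewrite S_INR. specialize (Hgap n). lra. }
  destruct (INR_archimed tau_min s Hmin) as [N HN]. exists N. specialize (H N). lra.
Qed.

Hypothesis t_unbounded : forall s, exists N, s < t N.

(** At a sampling time the left limit comes from the previous piece, which agrees
    there with the next one; hence the formula for [x] on closed intervals. *)
Lemma glue {W : NormedModule R_AbsRing} (u : nat -> R -> W) :
  (forall n s, continuous (u n) s) ->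
  (forall n, u (S n) 0 = u n (t (S n) - t n)) ->
  exists x : R -> W, continuous_on (fun s => 0 <= s) x /\
    forall n s, t n <= s <= t (S n) -> x s = u n (s - t n).
Proof.
  intros Hu Hjoin.
  (* The index of the interval containing [s], arbitrary for negative [s]. *)
  pose (index := fun s => epsilon (inhabits 0%nat) (fun n => t n <= s < t (S n))).
  pose (x := fun s => u (index s) (s - t (index s))).
  assert (Hint : forall s, 0 <= s -> exists n, t n <= s < t (S n)).
  { intros s Hs. destruct (t_unbounded s) as [N HN]. now apply (sampling_interval s N). }
  assert (Hindex : forall n s, t n <= s < t (S n) -> index s = n).
  { intros n s Hs. apply (sampling_interval_unique _ _ s); [|easy].
    apply (epsilon_spec (inhabits 0%nat) (fun n => t n <= s < t (S n))). now exists n. }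
  assert (Hx : forall n s, t n <= s <= t (S n) -> x s = u n (s - t n)).
  { intros n s Hs. destruct (Req_dec s (t (S n))) as [->|Hne].
    - generalize (t_incr (S n)). intros H. unfold x. rewrite (Hindex (S n)) by lra.
      rewrite Rminus_diag. apply Hjoin.
    - unfold x. rewrite (Hindex n) by lra. reflexivity. }
  exists x. split; [|exact Hx].
  assert (Hpiece : forall n s eps, t n <= s <= t (S n) -> 0 < eps ->
    exists d, 0 < d /\ forall r, Rabs (r - s) < d -> t n <= r <= t (S n) ->
      ndist (x r) (x s) < eps).
  { intros n s eps Hs He.
    destruct (proj1 (continuous_R_iff (u n) (s - t n)) (Hu n (s - t n)) eps He) as (d & Hd & H).
    exists d. split; [easy|]. intros r Hr Hrn. rewrite !(Hx n) by easy. apply H.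
    now replace (r - t n - (s - t n)) with (r - s) by ring. }
  apply continuous_on_R_iff. intros s Hs eps He.
  destruct (Hint s Hs) as [n Hn].
  destruct (Hpiece n s eps ltac:(lra) He) as (d & Hd & H).
  assert (Hleft : exists d', 0 < d' /\ forall r, Rabs (r - s) < d' -> 0 <= r -> r < t n ->
    ndist (x r) (x s) < eps).
  { destruct (Req_dec s (t n)) as [Heq|Hne].
    - destruct n as [|m].
      + exists 1. split; [lra|]. intros r _ Hr0 Hr1. lra.
      + generalize (t_incr m). intros Hm.
        destruct (Hpiece m s eps ltac:(lra) He) as (d' & Hd' & H').
        exists (Rmin d' (t (S m) - t m)). split; [apply Rmin_glb_lt; lra|].
        intros r Hr _ Hr1. apply Rmin_Rgt in Hr. destruct Hr as [Hr2 Hr3].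
        apply H'; [easy|]. apply Rgt_lt, Rabs_lt_between' in Hr3. lra.
    - exists (s - t n). split; [lra|]. intros r Hr _ Hr1.
      apply Rabs_lt_between' in Hr. lra. }
  destruct Hleft as (d' & Hd' & H').
  exists (Rmin d (Rmin d' (t (S n) - s))). split; [repeat apply Rmin_glb_lt; lra|].
  intros r Hr Hr0. apply Rmin_Rgt in Hr. destruct Hr as [Hr1 Hr].
  apply Rmin_Rgt in Hr. destruct Hr as [Hr2 Hr3].
  destruct (Rle_lt_dec (t n) r) as [Hge|Hlt].
  - apply H; [easy|]. apply Rgt_lt, Rabs_lt_between' in Hr3. lra.
  - now apply H'.
Qed.

End Sampling.

(** Stated for a filter [Q] between the neighbourhoods of [s] in [P] and the point
    [s], this covers both derivatives relative to [P] and ordinary derivatives at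
    interior points of [P]. *)
Lemma filterdiff_of_bound {W : NormedModule R_AbsRing} (Q : (R -> Prop) -> Prop)
    (P : R -> Prop) (f : R -> W) (s : R) (g : W) :
  (forall S : R -> Prop, Q S -> S s) ->
  (forall S : R -> Prop,
     (exists d, 0 < d /\ forall r, P r -> Rabs (r - s) < d -> S r) -> Q S) ->
  (forall eps, 0 < eps -> exists d, 0 < d /\ forall r, P r -> Rabs (r - s) < d ->
     ndist (minus (f r) (f s)) (scal (r - s) g) <= eps * Rabs (r - s)) ->
  filterdiff (U := R_NormedModule) f Q (fun h => scal h g).
Proof.
  intros HQs HQ Hb. split; [apply (is_linear_scal_l (K := R_AbsRing) g)|].
  intros r Hr.
  assert (Heq : r = s).
  { apply (ndist_eq_0 (W := R_NormedModule)). apply Rle_antisym; [|apply ndist_ge_0].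
    apply le_epsilon. intros eps He. rewrite Rplus_0_l. rewrite ndist_sym. apply Rlt_le.
    apply (HQs (fun s => ndist (W := R_NormedModule) s r < eps)).
    apply Hr. exact (locally_ball r (mkposreal eps He)). }
  subst r. intros eps. apply HQ. exact (Hb eps (cond_pos eps)).
Qed.

Section SamplingInterval.

Context {k : scalars} {X X' U : CompleteNormedModule k}.
Context (T : R -> X -> X) (T' : R -> X' -> X') (j : X -> X').
Context (B : U -> X') (F : X -> U) (phi : X -> X).
Hypothesis HT' : C0_semigroup T'.
Hypothesis j_T : forall t x, 0 <= t -> T' t (j x) = j (T t x).

(** One sampling interval of the integral equation is the mild equation on
    [[0, K]] with input [B F] of the initial value. *)
Lemma sampled_mild (y : R -> X) (u : R -> realify X) (a K : R) :
  (forall s, continuous (forcing (E := realify X) (E' := realify X') j phi (B (F (y a))) u) s) ->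
  0 <= K ->
  (forall s, 0 <= s <= K -> y (a + s) = u s) ->
  (forall tau, 0 < tau <= K -> exists I : X',
      is_RInt (V := realify X')
        (fun s => T' (tau - s) (plus (B (F (y a))) (j (phi (y (a + s)))))) 0 tau I /\
      j (y (a + tau)) = plus (j (T tau (y a))) I) <->
  mild_solution (E := realify X) (E' := realify X') T' j phi (y a) (B (F (y a))) K u.
Proof.
  intros Hc HK Hy. generalize (C0_semigroup_realify T' HT'). intros HTr.
  assert (Hext : forall tau s, 0 < tau <= K -> Rmin 0 tau < s < Rmax 0 tau ->
    T' (tau - s) (plus (B (F (y a))) (j (phi (y (a + s))))) =
    frozen (E := realify X') T' (tau - s)
      (forcing (E := realify X) (E' := realify X') j phi (B (F (y a))) u s)).
  { intros tau s Htau Hs. rewrite Rmin_left, Rmax_right in Hs by lra.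
    rewrite (frozen_eq (E := realify X')) by lra. now rewrite (Hy s) by lra. }
  split; intros H tau Htau.
  - destruct (Req_dec tau 0) as [->|Hne].
    + rewrite (frozen_0 (E := realify X') T' HTr), (conv_0 (E := realify X')).
      rewrite <- (Hy 0), Rplus_0_r by lra. symmetry. apply @plus_zero_r.
    + destruct (H tau ltac:(lra)) as (I & HI & Heq).
      rewrite <- (Hy tau), Heq by lra.
      rewrite (frozen_eq (E := realify X')), j_T by lra.
      rewrite (conv_unique (E := realify X') T' _ tau I); [reflexivity|].
      revert HI. apply is_RInt_ext. intros s Hs. apply Hext; [lra|easy].
  - exists (conv (E := realify X') T'
      (forcing (E := realify X) (E' := realify X') j phi (B (F (y a))) u) tau). split.
    + apply is_RInt_ext with (2 := conv_correct (E := realify X') T' HTr _ tau Hc).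
      intros s Hs. symmetry. apply Hext; [lra|easy].
    + rewrite (Hy tau), <- j_T by lra.
      rewrite <- (frozen_eq (E := realify X')) by lra. apply H. lra.
Qed.

End SamplingInterval.

Theorem theorem4p2 :
  forall (k : scalars) (X U : HilbertSpace k)
    (tau_min : R) (t : nat -> R)
    (T : R -> X -> X) (D : X -> Prop) (A : X -> X)
    (X' : CompleteNormedModule k) (j : X -> X')
    (T' : R -> X' -> X') (D' : X' -> Prop) (A' : X' -> X')
    (B : U -> X') (F : X -> U) (phi : X -> X) (L : R) (x0 : X),
  0 < tau_min ->
  t 0%nat = 0 ->
  (forall n, t n < t (S n)) ->
  (forall n, tau_min <= t (S n) - t n) ->
  C0_semigroup T ->
  is_generator T D A ->
  is_extrapolation_space D A X' j ->
  is_semigroup_extension j T T' ->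
  is_generator T' D' A' ->
  is_linear B ->
  compact_operator F ->
  phi zero = zero ->
  0 <= L ->
  (forall xi1 xi2, norm (minus (phi xi1) (phi xi2)) <= L * norm (minus xi1 xi2)) ->
  exists x : R -> X,
    (continuous_on (fun s => 0 <= s) x /\
     is_solution j T T' B F phi t x0 x) /\
    (forall y : R -> X,
       continuous_on (fun s => 0 <= s) y ->
       is_solution j T T' B F phi t x0 y ->
       forall s, 0 <= s -> y s = x s) /\
    (forall n, C1_on (fun s => t n <= s < t (S n)) (fun s => j (x s))) /\
    (forall n s, t n < s < t (S n) ->
       D' (j (x s)) /\
       is_derive (V := realify X') (fun r => j (x r)) s
         (plus (plus (A' (j (x s))) (B (F (x (t n))))) (j (phi (x s))))).
Proof.
  intros k X U tau_min t T D A X' j T' D' A' B F phi L x0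
    Hmin t_0 t_incr t_gap HT HA (lambda & Rl & HR & Hcompl) (HT' & j_T) HA' _ _ _ HL Hphi.
  destruct (extrapolated_generator T D A j T' lambda Rl HT HA HR Hcompl j_T)
    as (G & HG & HGgen & HGonto).
  assert (Hj : is_linear j) by exact (embedding_linear D A j lambda Rl HR Hcompl).
  assert (Hjr := is_linear_realify j Hj).
  assert (j_inj : forall x y, j x = j y -> x = y)
    by exact (embedding_injective D A j lambda Rl HR Hcompl).
  assert (HTr := C0_semigroup_realify T HT).
  assert (HTr' := C0_semigroup_realify T' HT').
  pose (E := realify X). pose (E' := realify X').
  assert (Hphir : forall x y : E, ndist (phi x) (phi y) <= L * ndist x y) by exact Hphi.
  pose (mild := fun (a : X) (K : R) (u : R -> E) =>
    mild_solution (E := E) (E' := E') T' j phi a (B (F a)) K u).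
  assert (Hforcing : forall (b : X') (u : R -> E), (forall s, continuous u s) ->
    forall s, continuous (forcing (E := E) (E' := E') j phi b u) s).
  { intros b u Hu. exact (forcing_continuous (E := E) (E' := E') j phi L Hjr HL Hphir b u Hu). }
  assert (Hex : forall (n : nat) (a : X), exists u : R -> E,
    (forall s, continuous u s) /\ mild a (t (S n) - t n) u).
  { intros n a. apply (mild_solution_exists (E := E) (E' := E') T T' j G phi L); try assumption.
    specialize (t_incr n). lra. }
  pose (piece := fun n a => proj1_sig (constructive_indefinite_description _ (Hex n a))).
  pose (sample := fix sample (n : nat) : X :=
    match n with
    | 0%nat => x0
    | S n => piece n (sample n) (t (S n) - t n)
    end).
  pose (u := fun n => piece n (sample n)).
  assert (Hu : forall n, (forall s, continuous (u n) s) /\ mild (sample n) (t (S n) - t n) (u n)).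
  { intros n. unfold u, piece. now destruct (constructive_indefinite_description _ _). }
  assert (Hgap : forall n, 0 <= t (S n) - t n) by (intros n; specialize (t_incr n); lra).
  assert (Hu0 : forall n, u n 0 = sample n).
  { intros n. apply (mild_solution_0 (E := E) (E' := E') T' j phi HTr' j_inj
      (sample n) (B (F (sample n))) _ (u n) (Hgap n)), Hu. }
  destruct (glue (W := E) t t_0 t_incr (sampling_unbounded t t_0 tau_min Hmin t_gap) u)
    as (x & Hxc & Hx).
  { intros n. apply Hu. }
  { intros n. rewrite Hu0. reflexivity. }
  assert (Hxt : forall n, x (t n) = sample n).
  { intros n. rewrite (Hx n), Rminus_diag by (specialize (t_incr n); lra). apply Hu0. }
  assert (Hxu : forall n s, 0 <= s <= t (S n) - t n -> x (t n + s) = u n s).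
  { intros n s Hs. rewrite (Hx n) by lra. f_equal. ring. }
  assert (Hsol : is_solution j T T' B F phi t x0 x).
  { split; [rewrite <- t_0; apply (Hxt 0%nat)|]. intros n.
    apply (sampled_mild T T' j B F phi HT' j_T x (u n) (t n) (t (S n) - t n)).
    - intros s. apply Hforcing, Hu.
    - apply Hgap.
    - apply Hxu.
    - rewrite Hxt. apply Hu. }
  assert (HA'j : forall v, D' (j v) /\ A' (j v) = G v).
  { intros v. assert (HD : D' (j v)) by (apply (proj1 HA'); now exists (G v)).
    split; [easy|].
    exact (filterlim_locally_unique (F := at_right 0) _ _ _ (proj2 HA' _ HD) (HGgen v)). }
  assert (Hbound : forall n s, t n <= s < t (S n) -> forall eps, 0 < eps ->
    exists d, 0 < d /\ forall r, t n <= r < t (S n) -> Rabs (r - s) < d ->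
      ndist (W := E') (minus (j (x r)) (j (x s)))
        (scal (r - s) (velocity (E := E) (E' := E') j G phi (B (F (x (t n)))) (u n) (s - t n)))
      <= eps * Rabs (r - s)).
  { intros n s Hs eps He.
    destruct (mild_solution_derivative (E := E) (E' := E') T' j G phi L HTr' Hjr HG HGgen HL Hphir
      (sample n) (B (F (sample n))) (t (S n) - t n) (u n) (s - t n) eps) as (d & Hd & H);
      [apply Hu|apply Hu|lra|easy|].
    exists d. split; [easy|]. intros r Hr Hrs.
    specialize (H (r - t n) ltac:(lra)).
    replace (r - t n - (s - t n)) with (r - s) in H by ring.
    rewrite Hxt, (Hx n r), (Hx n s) by lra. now apply H. }
  exists x. split; [split; [exact Hxc|exact Hsol]|]. split; [|split].
  - intros y Hyc [Hy0 Hy].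
    assert (Hpiece : forall n, y (t n) = x (t n) ->
      forall s, t n <= s <= t (S n) -> y s = x s).
    { intros n Hn s Hs.
      (* The competitor, read on one interval and frozen outside it. *)
      pose (v := fun s => y (t n + clamp (t (S n) - t n) s)).
      assert (Hv : forall s, continuous (v : R -> E) s).
      { exact (continuous_clamped (W := E) y (t n) (t (S n) - t n)
          (sampling_ge_0 t t_0 t_incr n) (Hgap n) Hyc). }
      assert (Hyv : forall s, 0 <= s <= t (S n) - t n -> y (t n + s) = v s).
      { intros r Hr. unfold v. now rewrite clamp_id. }
      assert (Hmv : mild (sample n) (t (S n) - t n) v).
      { rewrite <- Hxt, <- Hn.
        apply (sampled_mild T T' j B F phi HT' j_T y v (t n) (t (S n) - t n));
          [now apply Hforcing|apply Hgap|exact Hyv|exact (Hy n)]. }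
      replace s with (t n + (s - t n)) by ring.
      rewrite Hyv, Hxu by lra.
      apply (mild_solution_unique (E := E) (E' := E') T T' j phi L HTr HTr' Hjr j_inj j_T HL Hphir
        (sample n) (B (F (sample n))) (t (S n) - t n)); try easy; [apply Hu|apply Hu|lra]. }
    assert (Hall : forall n, y (t n) = x (t n)).
    { induction n as [|n IH].
      - rewrite t_0, Hy0. symmetry. apply Hsol.
      - apply (Hpiece n IH). specialize (t_incr n). lra. }
    intros s Hs. destruct (sampling_unbounded t t_0 tau_min Hmin t_gap s) as [N HN].
    destruct (sampling_interval t t_0 s N) as [n Hn]; [lra|].
    apply (Hpiece n (Hall n)). lra.
  - intros n.
    exists (fun s => velocity (E := E) (E' := E') j G phi (B (F (x (t n)))) (u n) (s - t n)).
    split.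
    + intros s Hs.
      refine (proj2 (continuous_on_R_iff (W := E') _ _) _ s Hs). intros r Hr eps He.
      destruct (proj1 (continuous_R_iff (W := E') _ (r - t n))
        (velocity_continuous (E := E) (E' := E') j G phi L Hjr HG HL Hphir
          (B (F (x (t n)))) (u n) (proj1 (Hu n)) (r - t n)) eps He) as (d & Hd & H).
      exists d. split; [easy|]. intros q Hq _. apply H.
      now replace (q - t n - (r - t n)) with (q - r) by ring.
    + intros s Hs. refine (filterdiff_of_bound (W := E') _ (fun s => t n <= s < t (S n))
        (fun s => j (x s)) s _ _ _ _).
      * intros P HP. exact (locally_singleton s _ HP Hs).
      * intros P (d & Hd & H). apply locally_R_iff. exists d. split; [easy|].
        intros r Hr Hrn. now apply H.
      * exact (Hbound n s Hs).
  - intros n s Hs. destruct (HA'j (x s)) as [HD HAG]. split; [easy|].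
    replace (plus (plus (A' (j (x s))) (B (F (x (t n))))) (j (phi (x s)))) with
      (velocity (E := E) (E' := E') j G phi (B (F (x (t n)))) (u n) (s - t n)).
    + refine (filterdiff_of_bound (W := E') _ (fun s => t n <= s < t (S n))
        (fun s => j (x s)) s _ _ _ _).
      * intros P HP. exact (locally_singleton s _ HP).
      * intros P (d & Hd & H). apply locally_R_iff.
        exists (Rmin d (Rmin (s - t n) (t (S n) - s))). split; [repeat apply Rmin_glb_lt; lra|].
        intros r Hr. apply Rmin_Rgt in Hr. destruct Hr as [Hr1 Hr].
        apply Rmin_Rgt in Hr. destruct Hr as [Hr2 Hr3].
        apply Rgt_lt, Rabs_lt_between' in Hr2. apply Rgt_lt, Rabs_lt_between' in Hr3.
        apply H; [lra|easy].
      * apply (Hbound n s). lra.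
    + unfold velocity, forcing. rewrite HAG, (Hx n s) by lra. apply (plus_assoc (G := E')).
Qed.
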